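(* Let $\mathrm{El}_3$ be the coarse moduli space (over $\mathbb{C}$, defined up to birational isomorphism) of pairs $(C,L)$ consisting of an elliptic curve $C$ and a line bundle $L$ of degree $3$ on $C$, identified with the GIT-quotient $\mathbb{P}(\mathbb{C}[X,Y,Z]_3)/\!/\mathrm{SL}(3)\cong\mathbb{P}^1$ of the space of plane cubic curves. Let $\mathsf{H}\colon \mathrm{El}_3\dashrightarrow \mathrm{El}_3$ be the rational self-map defined by the Hessian covariant of ternary cubic forms, i.e. the map sending the class of the plane cubic curve $F=0$ to the class of the plane cubic curve $\mathrm{He}(F)=0$. Then the degree of $\mathsf{H}$ is equal to $3$.
   Context: The ground field is $\mathbb{C}$. Moduli problem: to a scheme $S$ one assigns the set of flat proper morphisms $p\colon X\to S$ of relative dimension 1 together with an invertible sheaf $\mathcal{L}$ on $X$ such that $p$ is smooth over an open dense subset of $S$ with elliptic curves as fibres, and the restriction $\mathcal{L}_s$ of $\mathcal{L}$ to each fibre $X_s$ is an invertible sheaf of degree $3$. Two families $(X\to S,\mathcal{L})$, $(X'\to S,\mathcal{L}')$ are equivalent if there are an open dense $V\subset S$ and an isomorphism of $V$-schemes $X_V\to X'_V$ under which the restrictions of the sheaves correspond. The coarse moduli space is a scheme, unique up to birational isomorphism, receiving a universal morphism of functors from this moduli functor to its functor of points in the category of schemes with rational maps as morphisms, and bijective on $\mathbb{C}$-points. It is birationally isomorphic to the GIT-quotient $\mathbb{P}(\mathbb{C}[X,Y,Z]_3)/\!/\mathrm{SL}(3)$: a pair $(C,L)$ corresponds to the plane cubic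 that is the image of $C$ under the embedding in $\mathbb{P}^2$ given by $L$. Here $\mathbb{C}[X,Y,Z]_3$ is the space of homogeneous polynomials of degree $3$, $\mathbb{P}(\cdot)$ is the space of nonzero polynomials up to scaling, and the GIT-quotient is $\mathrm{Proj}\,\mathbb{C}[\mathsf{S},\mathsf{T}]\cong\mathbb{P}^1$, where $\mathsf{S},\mathsf{T}$ are the Aronhold invariants of degrees $4$ and $6$, which generate the algebra of $\mathrm{SL}(3)$-invariant polynomial functions on $\mathbb{C}[X,Y,Z]_3$. The Hessian $\mathrm{He}(F)$ of $F\in\mathbb{C}[X,Y,Z]_3$ is the determinant of the $3\times 3$ matrix of second partial derivatives of $F$; it is again a ternary cubic form, and $F\mapsto\mathrm{He}(F)$ is $\mathrm{SL}(3)$-equivariant, so it induces a rational self-map of the GIT-quotient. The degree of a dominant rational map between varieties of the same dimension is the degree of the corresponding extension of function fields. *)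

(* Defs.v *)
From HB Require Import structures.
From mathcomp Require Import all_boot all_algebra.
From mathcomp Require Import boolp reals.
From mathcomp Require Import complex mpoly.

Set Implicit Arguments.
Unset Strict Implicit.
Unset Printing Implicit Defensive.

Import GRing.Theory.
Local Open Scope ring_scope.

(* A ternary cubic form is F : {mpoly K[3]} with F \is 3.-homog (0 included). *)

Section TernaryCubics.
Context (K : fieldType).

(* The coordinates of K[X,Y,Z]_3 are indexed by
   X^3, Y^3, Z^3, X^2Y, X^2Z, Y^2X, Y^2Z, Z^2X, Z^2Y, XYZ, in this order. *)
Definition cubic_monomials : 10.-tuple 'X_{1..3} :=
  [tuple [multinom [tuple 3; 0; 0]]; [multinom [tuple 0; 3; 0]];
         [multinom [tuple 0; 0; 3]]; [multinom [tuple 2; 1; 0]];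
         [multinom [tuple 2; 0; 1]]; [multinom [tuple 1; 2; 0]];
         [multinom [tuple 0; 2; 1]]; [multinom [tuple 1; 0; 2]];
         [multinom [tuple 0; 1; 2]]; [multinom [tuple 1; 1; 1]]]%N.

Definition coefs (F : {mpoly K[3]}) (i : 'I_10) : K :=
  F@_(tnth cubic_monomials i).

(* {mpoly K[10]} is the algebra of polynomial functions on K[X,Y,Z]_3, the
   function given by I being F |-> I.@[coefs F]. *)

(* Linear change of variables X_i |-> \sum_j g_ij X_j.  This is a right action;
   it has the same invariants as the left action through g^-1. *)
Definition lin_subst (g : 'M[K]_3) (F : {mpoly K[3]}) : {mpoly K[3]} :=
  F \mPo [tuple \sum_(j < 3) g i j *: 'X_j | i < 3].

Definition SL3_invariant (I : {mpoly K[10]}) : Prop :=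
  forall (g : 'M[K]_3) (F : {mpoly K[3]}), \det g = 1 -> F \is 3.-homog ->
    I.@[coefs (lin_subst g F)] = I.@[coefs F].

Definition hessian (F : {mpoly K[3]}) : {mpoly K[3]} :=
  \det (\matrix_(i < 3, j < 3) (F^`M(i))^`M(j)).

Lemma hessian_homog (F : {mpoly K[3]}) :
  F \is 3.-homog -> hessian F \is 3.-homog.
Proof.
move=> hF; rewrite /hessian /determinant; apply: rpred_sum => s _.
rewrite -signr_odd mulr_sign.
have dh d (p : {mpoly K[3]}) (i : 'I_3) :
    p \is d.+1.-homog -> p^`M(i) \is d.-homog.
  move=> hp; apply/dhomogP => m; rewrite mcoeff_msupp mcoeff_deriv => nz.
  have mi : (m + U_(i))%MM \in msupp p.
    by rewrite mcoeff_msupp; apply: contraNneq nz => ->; rewrite mul0rn.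
  have := dhomog_mf hp mi; rewrite mfD /= mdeg1 addn1; exact: succn_inj.
set P := \prod_(i < 3) _.
have hP : P \is 3.-homog.
  rewrite /P !big_ord_recl big_ord0 mulr1 !mxE.
  have h1 i j : F^`M(i)^`M(j) \is 1.-homog by apply/dh/dh.
  by apply: (@dhomogM _ _ mdeg 1 _ 2) => //; apply: (@dhomogM _ _ mdeg 1 _ 1).
by case: ifP => // _; rewrite dhomogN.
Qed.

(* The GIT-quotient P(K[X,Y,Z]_3)//SL(3) is Proj of the graded algebra of
   invariants: its points are the classes of the semistable forms, and its
   function field consists of the quotients f / g of invariants of the same
   degree. *)
Definition semistable (F : {mpoly K[3]}) : Prop :=
  exists (d : nat) (I : {mpoly K[10]}),
    [/\ (0 < d)%N, I \is d.-homog, SL3_invariant I & I.@[coefs F] != 0].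

Definition invariant_fraction (x : {fraction {mpoly K[10]}}) (d : nat)
    (f g : {mpoly K[10]}) : Prop :=
  [/\ f \is d.-homog /\ SL3_invariant f, g \is d.-homog /\ SL3_invariant g,
      g != 0 & x = tofrac f / tofrac g].

Definition El3_pred (x : {fraction {mpoly K[10]}}) : bool :=
  `[< exists d f g, invariant_fraction x d f g >].

Lemma El3_divring_closed : divring_closed El3_pred.
Proof.
have invM f g : SL3_invariant f -> SL3_invariant g -> SL3_invariant (f * g).
  by move=> hf hg s F ds hF; rewrite !mevalM hf // hg.
have invB f g : SL3_invariant f -> SL3_invariant g -> SL3_invariant (f - g).
  by move=> hf hg s F ds hF; rewrite !mevalB hf // hg.
split.
- apply/asboolP; exists 0%N, 1, 1; split=> //.
  + by split; [exact: dhomog1 | move=> s F _ _; rewrite !meval1].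
  + by split; [exact: dhomog1 | move=> s F _ _; rewrite !meval1].
  + exact: oner_neq0.
  + by rewrite rmorph1 divr1.
- move=> x y /asboolP[d [f [g [[hf If] [hg Ig] g0 ->]]]].
  move=> /asboolP[e [f' [g' [[hf' If'] [hg' Ig'] g0' ->]]]].
  apply/asboolP; exists (d + e)%N, (f * g' - f' * g), (g * g'); split.
  + split; last by apply: invB; apply: invM.
    by rewrite rpredB //; [|rewrite addnC]; apply: dhomogM.
  + by split; [apply: dhomogM | apply: invM].
  + by rewrite mulf_neq0.
  + rewrite rmorphB !rmorphM -[- (tofrac f' / _)]mulNr.
    by rewrite addf_div ?tofrac_eq0 // mulNr.
- move=> x y /asboolP[d [f [g [[hf If] [hg Ig] g0 ->]]]].
  move=> /asboolP[e [f' [g' [[hf' If'] [hg' Ig'] g0' ->]]]].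
  have [f0'|f0'] := eqVneq f' 0.
    rewrite f0' rmorph0 mul0r invr0 mulr0.
    apply/asboolP; exists d, 0, g; split=> //; last by rewrite rmorph0 mul0r.
    by split; [exact: rpred0 | move=> s F _ _; rewrite !meval0].
  apply/asboolP; exists (d + e)%N, (f * g'), (g * f'); split.
  + by split; [apply: dhomogM | apply: invM].
  + by split; [apply: dhomogM | apply: invM].
  + by rewrite mulf_neq0.
  + by rewrite invf_div mulf_div !rmorphM.
Qed.

HB.instance Definition _ :=
  GRing.isDivringClosed.Build _ El3_pred El3_divring_closed.

(* The function field of the GIT-quotient, i.e. of El_3. *)
Record El3_field : Type := El3_fun {
  El3_val :> {fraction {mpoly K[10]}};
  El3_valP : El3_pred El3_val
}.

HB.instance Definition _ := [isSub for El3_val].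
HB.instance Definition _ := [Choice of El3_field by <:].
HB.instance Definition _ := [SubChoice_isSubComNzRing of El3_field by <:].

Lemma El3_inv_subproof (x : El3_field) : El3_pred (El3_val x)^-1.
Proof.
have xP : El3_val x \in El3_pred by exact: El3_valP.
by rewrite -rpredV in xP.
Qed.

Definition El3_inv (x : El3_field) : El3_field :=
  El3_fun (El3_inv_subproof x).

Lemma El3_mulVf (x : El3_field) : x != 0 -> El3_inv x * x = 1.
Proof.
move=> x0; apply: val_inj; rewrite rmorphM rmorph1.
apply: mulVf; apply: contra_neq x0 => x0.
by apply: val_inj; rewrite rmorph0.
Qed.

Lemma El3_invr0 : El3_inv 0 = 0.
Proof. by apply: val_inj; rewrite rmorph0 /= invr0. Qed.

HB.instance Definition _ :=
  GRing.ComNzRing_isField.Build El3_field El3_mulVf El3_invr0.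

(* The rational function phi is regular at the class of the semistable form F,
   with value v. *)
Definition value_at (phi : El3_field) (F : {mpoly K[3]}) (v : K) : Prop :=
  exists d f g, [/\ invariant_fraction (El3_val phi) d f g,
                    g.@[coefs F] != 0 & v = f.@[coefs F] / g.@[coefs F]].

(* H is the comorphism phi |-> phi \o h of the rational self-map
   [F] |-> [h F] of the GIT-quotient; the first clause says that this map is
   defined somewhere, hence on a dense open subset.  That there is such a
   morphism of fields, necessarily injective, means that the map is dominant. *)
Definition is_comorphism (h : {mpoly K[3]} -> {mpoly K[3]})
    (H : {rmorphism El3_field -> El3_field}) : Prop :=
  (exists F, [/\ F \is 3.-homog, semistable F & semistable (h F)]) /\
  forall F phi v, F \is 3.-homog -> semistable F -> semistable (h F) ->
    value_at phi (h F) v -> value_at (H phi) F v.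

End TernaryCubics.

(* [M : phi(L)] = n, witnessed by a basis of M as an L-vector space. *)
Definition extension_degree (L M : fieldType) (phi : {rmorphism L -> M})
    (n : nat) : Prop :=
  exists b : 'I_n -> M, forall y : M,
    exists! c : {ffun 'I_n -> L}, y = \sum_(i < n) phi (c i) * b i.

(* Main.v *)
Require Import Defs.
From HB Require Import structures.
From mathcomp Require Import all_boot all_algebra.
From mathcomp Require Import boolp reals.
From mathcomp Require Import complex mpoly.
From mathcomp Require Import ring zify.

(** Let E be the function field of El_3 and H : E -> E the comorphism of the
    Hessian map.  Both are read off on the Hesse pencil
    F_t = x^3 + y^3 + z^3 + t xyz.

    A general cubic is equivalent to a member of the pencil, so a homogeneous
    invariant that vanishes on the pencil is zero ([invariant_eq0]), and
    restriction to the pencil is a morphism rho from E to M = K(t).  The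
    pencil is stable under the Hessian: He(F_t) = -6t^2 F_s with
    s = -(t^3 + 108) / (3t^2) ([hessian_hesse_form]).  Hence, if theta is the
    endomorphism t |-> s of M, then theta \o rho = rho \o H
    ([pencil_eval_pullback]); this also shows that the pullback of a nonzero
    invariant along the Hessian is nonzero, which is what makes H well defined
    ([hessian_pullback_morphism]).

    The degree of theta is 3, since t is a root of X^3 + 3s X^2 + 108 and the
    numerator t^3 + 108 and the denominator of s are coprime
    ([hessian_parameter_basis]).  The degree n of M over rho(E) is finite as
    soon as E contains one nonconstant function; such a function is
    S(He F) / S(F)^3 for the Aronhold invariant S, because S vanishes on the
    Fermat cubic F_0 but not on its Hessian, which is proportional to xyz
    ([pencil_restriction_algebraic]).

    Finally count the degree of M over rho(H(E)) = theta(rho(E)) in two ways: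
    it is n [E : H(E)] through rho(E) and 3 n through theta(M).  Cancelling n
    gives [E : H(E)] = 3, whatever n is ([conjugate_basis]). *)

Set Implicit Arguments.
Unset Strict Implicit.
Unset Printing Implicit Defensive.
Import GRing.Theory Num.Theory.
Local Open Scope ring_scope.

(** * Bases of a field over the image of another field *)

Section Families.
Variables (L M : fieldType) (phi : {rmorphism L -> M}).

Definition free_over (I : finType) (b : I -> M) : Prop :=
  forall c : I -> L, \sum_i phi (c i) * b i = 0 -> forall i, c i = 0.

Definition in_span (J : finType) (u : J -> M) (y : M) : Prop :=
  exists c : J -> L, y = \sum_j phi (c j) * u j.

(** Steinitz: with more rows than columns, the matrix of coordinates of [b] on
    [u] has a nonzero vector in its left kernel, that is, a relation. *)
Lemma free_over_leq_card (I J : finType) (b : I -> M) (u : J -> M) :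
  free_over b -> (forall i, in_span u (b i)) -> (#|I| <= #|J|)%N.
Proof.
move=> b_free /fin_all_exists[A bE]; rewrite leqNgt; apply/negP => ltJI.
pose B := \matrix_(i < #|I|, j < #|J|) A (enum_val i) (enum_val j).
have : ~~ row_free B.
  by rewrite /row_free neq_ltn (leq_ltn_trans (rank_leq_col B) ltJI).
rewrite -kermx_eq0 -nz_row_eq0; set v := nz_row _ => /eqP v0.
have vB : v *m B = 0 by apply/sub_kermxP; exact: nz_row_sub.
apply: v0; apply/rowP => i; rewrite mxE.
rewrite -(enum_valK i); apply: (b_free (fun i => v 0 (enum_rank i))).
under eq_bigr do rewrite bE mulr_sumr.
rewrite exchange_big big1 // => j _ /=.
under eq_bigr do rewrite mulrA -rmorphM.
rewrite -mulr_suml -rmorph_sum [X in phi X](_ : _ = 0) ?rmorph0 ?mul0r //.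
have := congr1 (fun w : 'rV_ _ => w 0 (enum_rank j)) vB; rewrite !mxE => vBj.
rewrite -[RHS]vBj.
rewrite (reindex (@enum_val I predT)) /=; last first.
  by apply: onW_bij; apply: enum_val_bij.
by apply: eq_big => [k|k _]; rewrite ?inE // !mxE enum_valK enum_rankK.
Qed.

Lemma max_free_spans k (b : 'I_k -> M) :
  free_over b -> (forall b' : 'I_k.+1 -> M, ~ free_over b') ->
  forall y, in_span b y.
Proof.
move=> b_free no_free y.
pose b' i := if unlift ord0 i is Some j then b j else y.
have [c /not_implyP[c_rel]] : exists c : 'I_k.+1 -> L,
    ~ (\sum_i phi (c i) * b' i = 0 -> forall i, c i = 0).
  by apply/existsNP/no_free.
move=> /existsNP[i0 /eqP ci0].
move: c_rel; rewrite big_ord_recl /b' unlift_none.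
under eq_bigr do rewrite liftK.
move=> c_rel; have [c00|c00] := eqVneq (c ord0) 0.
  move: c_rel ci0; rewrite c00 rmorph0 mul0r add0r => /b_free c0.
  by case: (unliftP ord0 i0) => [j ->|->]; rewrite ?c00 ?c0 eqxx.
exists (fun j => - ((c ord0)^-1 * c (lift ord0 j))).
move/eqP: c_rel; rewrite addr_eq0 => /eqP c_rel.
apply: (mulfI (x := phi (c ord0))); first by rewrite fmorph_eq0.
rewrite c_rel -sumrN mulr_sumr; apply: eq_bigr => j _.
by rewrite mulrA -rmorphM mulrN mulrA divff // mul1r rmorphN mulNr.
Qed.

(** Finiteness of a degree is obtained from a bound on free families alone,
    without exhibiting generators of the large field. *)
Lemma bounded_free_basis N :
  (forall k (b : 'I_k -> M), free_over b -> (k <= N)%N) ->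
  exists k (b : 'I_k -> M), free_over b /\ forall y, in_span b y.
Proof.
move=> bnd; pose P k := `[< exists b : 'I_k -> M, free_over b >].
have P0 : P 0%N by apply/asboolP; exists (fun=> 0) => c _ [].
have Pbnd k : P k -> (k <= N)%N by move=> /asboolP[b /bnd].
case: (ex_maxnP (ex_intro _ 0%N P0) Pbnd) => k /asboolP[b b_free] kmax.
exists k, b; split=> //; apply: max_free_spans => // b' b'_free.
suff : (k.+1 <= k)%N by rewrite ltnn.
by apply: kmax; apply/asboolP; exists b'.
Qed.

End Families.

Section Tower.
Variables (A B C : fieldType).
Variables (alpha : {rmorphism A -> B}) (beta : {rmorphism B -> C}).
Variables (I J : finType) (a : I -> B) (b : J -> C).

Definition tower_family (ij : I * J) : C := beta (a ij.1) * b ij.2.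

Lemma tower_family_sum (c : I * J -> A) :
  \sum_ij (beta \o alpha) (c ij) * tower_family ij =
  \sum_j beta (\sum_i alpha (c (i, j)) * a i) * b j.
Proof.
transitivity (\sum_i \sum_j beta (alpha (c (i, j))) * (beta (a i) * b j)).
  by rewrite pair_bigA; apply: eq_bigr => -[i j] _.
rewrite exchange_big /=; apply: eq_bigr => j _; rewrite rmorph_sum mulr_suml.
by apply: eq_bigr => i _; rewrite rmorphM mulrA.
Qed.

Lemma free_tower : free_over alpha a -> free_over beta b ->
  free_over (beta \o alpha) tower_family.
Proof.
move=> fa fb c; rewrite tower_family_sum => /fb c0 [i j].
exact: (fa (fun i => c (i, j)) (c0 j)).
Qed.

Lemma span_tower : (forall y, in_span alpha a y) ->
  (forall y, in_span beta b y) ->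
  forall y, in_span (beta \o alpha) tower_family y.
Proof.
move=> sa sb y; have [c ->] := sb y.
have /fin_all_exists[d cE] j := sa (c j).
exists (fun ij => d ij.2 ij.1); rewrite tower_family_sum.
by apply: eq_bigr => j _; rewrite cE.
Qed.

End Tower.

Section Transfer.
Variables (E M : fieldType) (rho : {rmorphism E -> M}).
Variables (H : {rmorphism E -> E}) (theta : {rmorphism M -> M}).
Hypothesis comm : forall x, theta (rho x) = rho (H x).

(** Both [theta \o rho] and [rho \o H] embed E in M.  A basis of M along the
    first has [k * n] elements; along the second, a family of [m] elements free
    over [H] yields a free family of [m * n] elements, and a basis of [E] over
    [H] yields a basis.  So every free family over [H] has at most [k]
    elements, and a maximal one has exactly [k]. *)
Lemma conjugate_basis n k (u : 'I_n -> M) (w : 'I_k -> M) :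
    free_over rho u -> (forall y, in_span rho u y) ->
    free_over theta w -> (forall y, in_span theta w y) ->
  exists e : 'I_k -> E, free_over H e /\ forall y, in_span H e y.
Proof.
move=> fu su fw sw.
have n_gt0 : (0 < n)%N.
  case: n u fu su => // u _ /(_ 1)[c]; rewrite big_ord0 => /eqP.
  by rewrite oner_eq0.
have sumE (I : finType) (b : I -> M) c :
    \sum_i (theta \o rho) (c i) * b i = \sum_i (rho \o H) (c i) * b i.
  by apply: eq_bigr => i _ /=; rewrite comm.
have free_rhoH (I : finType) (b : I -> M) :
    free_over (theta \o rho) b -> free_over (rho \o H) b.
  by move=> fb c; rewrite -sumE; apply: fb.
have span_rhoH (I : finType) (b : I -> M) y :
    in_span (theta \o rho) b y -> in_span (rho \o H) b y.
  by case=> c ->; exists c; rewrite sumE.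
have ft := free_tower fu fw; have st := span_tower su sw.
have bnd m (e : 'I_m -> E) : free_over H e -> (m <= k)%N.
  move=> fe; have := free_over_leq_card (free_tower fe fu).
  move=> /(_ _ _ (fun ij => span_rhoH _ _ _ (st _))).
  by rewrite !card_prod !card_ord mulnC leq_pmul2l.
have [m [e [fe se]]] := bounded_free_basis bnd.
suff <- : m = k by exists e.
apply/eqP; rewrite eqn_leq (bnd _ _ fe) /=.
have := free_over_leq_card (free_rhoH _ _ ft).
move=> /(_ _ _ (fun ij => span_tower se su _)).
by rewrite !card_prod !card_ord mulnC leq_pmul2r.
Qed.

End Transfer.

(** * Morphisms defined on fractions *)

(** The relation [rep x f g] reads: the fraction f / g represents x.  It covers
    at once the fraction field of a domain and fields of fractions f / g with f
    and g in a prescribed class, such as invariants of equal degree. *)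
Section ExtendToFractions.
Variables (D : comNzRingType) (E M : fieldType) (sigma : {rmorphism D -> M}).
Variable rep : E -> D -> D -> Prop.
Hypothesis rep_ex : forall x, exists f g, rep x f g.
Hypothesis rep_den : forall x f g, rep x f g -> sigma g != 0.
Hypothesis rep_cross : forall x f g f' g',
  rep x f g -> rep x f' g' -> f * g' = f' * g.
Hypothesis rep1 : rep 1 1 1.
Hypothesis repB : forall x f g y f' g',
  rep x f g -> rep y f' g' -> rep (x - y) (f * g' - f' * g) (g * g').
Hypothesis repM : forall x f g y f' g',
  rep x f g -> rep y f' g' -> rep (x * y) (f * f') (g * g').

Lemma extend_to_fractions : exists h : {rmorphism E -> M},
  forall x f g, rep x f g -> h x = sigma f / sigma g.
Proof.
have /choice[num /choice[den repE]] := rep_ex.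
pose h x := sigma (num x) / sigma (den x).
have hE x f g : rep x f g -> h x = sigma f / sigma g.
  move=> xfg; apply/eqP; rewrite eqr_div ?(rep_den xfg) ?(rep_den (repE x)) //.
  by rewrite -!rmorphM (rep_cross (repE x) xfg).
have h_zmod : zmod_morphism h.
  move=> x y; rewrite (hE _ _ _ (repB (repE x) (repE y))).
  have dx := rep_den (repE x); have dy := rep_den (repE y).
  rewrite /h rmorphB !rmorphM -[- (sigma (num y) / _)]mulNr.
  by rewrite addf_div // mulNr.
have h_monoid : monoid_morphism h.
  split=> [|x y]; first by rewrite (hE _ _ _ rep1) rmorph1 divr1.
  by rewrite (hE _ _ _ (repM (repE x) (repE y))) !rmorphM mulf_div.
pose hz := GRing.isZmodMorphism.Build E M h h_zmod.
pose hm := GRing.isMonoidMorphism.Build E M h h_monoid.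
pose hr : {rmorphism E -> M} := HB.pack h hz hm.
by exists hr.
Qed.

End ExtendToFractions.

Section Fractions.
Variable D : idomainType.

Lemma fractionP (x : {fraction D}) :
  exists f g : D, g != 0 /\ x = tofrac f / tofrac g.
Proof.
elim/quotW: x => y; exists (\n_y), (\d_y); have d0 := denom_ratioP y.
split=> //; apply: (mulIf (x := tofrac \d_y)); rewrite ?tofrac_eq0 //.
rewrite divfK ?tofrac_eq0 //.
rewrite !piE /tofrac; unlock.
apply/eqmodP; rewrite /= FracField.equivfE /FracField.mulf.
rewrite !numden_Ratio ?mulr1 ?oner_neq0 //.
by rewrite mulrC.
Qed.

Lemma common_denominator (I : finType) (x : I -> {fraction D}) :
  exists (g : D) (f : I -> D),
    g != 0 /\ forall i, x i = tofrac (f i) / tofrac g.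
Proof.
have /fin_all_exists[f /fin_all_exists[g xE]] i := fractionP (x i).
exists (\prod_i g i), (fun i => f i * \prod_(j | j != i) g j).
have g0 (P : pred I) : \prod_(j | P j) g j != 0.
  by apply/prodf_neq0 => j _; case: (xE j).
split=> [|i]; first exact: g0.
have [gi0 ->] := xE i; rewrite [\prod_j g j](bigD1 i) //= !tofracM -mulf_div.
by rewrite divff ?mulr1 // tofrac_eq0.
Qed.

Lemma fraction_lift (M : fieldType) (sigma : {rmorphism D -> M}) :
  injective sigma ->
  exists h : {rmorphism {fraction D} -> M}, forall f, h (tofrac f) = sigma f.
Proof.
move=> sigma_inj.
pose rep (x : {fraction D}) f g := g != 0 /\ x = tofrac f / tofrac g.
have [h hE] : exists h : {rmorphism {fraction D} -> M},
    forall x f g, rep x f g -> h x = sigma f / sigma g.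
  apply: extend_to_fractions => //.
  - exact: fractionP.
  - by move=> x f g [g0 _]; rewrite -(rmorph0 sigma) (inj_eq sigma_inj).
  - move=> x f g f' g' [g0 ->] [g'0 /eqP].
    rewrite eqr_div ?tofrac_eq0 // -!rmorphM /= tofrac_eq.
    by move=> /eqP.
  - by split; [exact: oner_neq0 | rewrite rmorph1 divr1].
  - move=> x f g y f' g' [g0 ->] [g'0 ->]; split; first by rewrite mulf_neq0.
    rewrite rmorphB !rmorphM -[- (tofrac f' / _)]mulNr.
    by rewrite addf_div ?tofrac_eq0 // mulNr.
  - move=> x f g y f' g' [g0 ->] [g'0 ->]; split; first by rewrite mulf_neq0.
    by rewrite !rmorphM mulf_div.
exists h => f; rewrite (hE _ f 1) ?rmorph1 ?divr1 //.
by split; [exact: oner_neq0 | rewrite rmorph1 divr1].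
Qed.

End Fractions.

(** * The endomorphism of K(t) induced by the Hessian *)

Section RationalFunctions.
Variable K : fieldType.
Local Notation M := {fraction {poly K}}.

Definition fraction_const : {rmorphism K -> M} := (@tofrac {poly K}) \o polyC.
Definition fraction_var : M := tofrac 'X.

Lemma tofrac_horner (p : {poly K}) :
  tofrac p = (map_poly fraction_const p).[fraction_var].
Proof.
by rewrite map_poly_comp horner_map -[in LHS](comp_polyXr p).
Qed.

(** If t is a root of P, then reduction modulo P shows that K[t] is spanned by
    the powers of t below the degree of P; a finite family in K(t) is brought
    into K[t] by multiplying by a common denominator, which keeps it free. *)
Lemma free_over_bound (L : fieldType) (phi : {rmorphism L -> M})
    (P : {poly L}) k (b : 'I_k -> M) :
    (forall a, exists l, phi l = fraction_const a) ->
    P != 0 -> root (map_poly phi P) fraction_var ->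
  free_over phi b -> (k <= (size P).-1)%N.
Proof.
move=> /choice[kappa kappaE] P0 P_root b_free.
have [g [f [g0 bE]]] := common_denominator b.
have f_free : free_over phi (fun i => tofrac (f i)).
  move=> c c_rel; apply: b_free; under eq_bigr do rewrite bE mulrA.
  by rewrite -mulr_suml c_rel mul0r.
pose u (j : 'I_(size P).-1) := fraction_var ^+ j.
rewrite -[k]card_ord -[X in (_ <= X)%N]card_ord.
apply: (free_over_leq_card f_free (u := u)) => i.
pose Q := \poly_(j < size (f i)) kappa (f i)`_j.
have -> : tofrac (f i) = (map_poly phi (Q %% P)).[fraction_var].
  have -> : tofrac (f i) = (map_poly phi Q).[fraction_var].
    rewrite tofrac_horner; congr horner; apply/polyP => j.
    rewrite !coef_map coef_poly; case: ltnP => [_|szj].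
      exact: (esym (kappaE _)).
    by rewrite nth_default // !raddf0.
  rewrite {1}(divp_eq Q P) rmorphD rmorphM hornerD hornerM.
  by rewrite (eqP P_root) mulr0 add0r.
exists (fun j : 'I_(size P).-1 => (Q %% P)`_j).
rewrite (@horner_coef_wide _ (size P).-1) ?size_map_poly; last first.
  by rewrite -ltnS prednK ?size_poly_gt0 // ltn_modp.
by apply: eq_bigr => j _; rewrite coef_map.
Qed.

End RationalFunctions.

Lemma hessian_parameter_eq (F : fieldType) (t : F) :
  3%:R * t ^+ 2 != 0 ->
  3%:R * (- (t ^+ 3 + 108%:R) / (3%:R * t ^+ 2)) * t ^+ 2 = - (t ^+ 3 + 108%:R).
Proof. by move=> d0; rewrite mulrAC mulrC divfK. Qed.

Lemma map_cubic_horner (F G : fieldType) (phi : {rmorphism F -> G}) a b x :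
  (map_poly phi ('X^3 + (a *: 'X^2 + b%:P))).[x] =
  x ^+ 3 + (phi a * x ^+ 2 + phi b).
Proof.
by rewrite !rmorphD /= map_polyZ !map_polyXn map_polyC !hornerE.
Qed.

Section CubicSubstitution.
Variable K : numFieldType.
Local Notation M := {fraction {poly K}}.
Local Notation t := (fraction_var K).
Local Notation cst := (fraction_const K).

(* The numerator and the denominator of the parameter s = p / q below. *)
Let p : {poly K} := 'X^3 + 108%:P.
Let q : {poly K} := - 3%:P * 'X^2.

(** The Hessian of F_t = x^3 + y^3 + z^3 + t xyz is the multiple -6t^2 F_s of
    the member of the pencil with this parameter s. *)
Definition hessian_parameter : M := - (t ^+ 3 + 108) / (3 * t ^+ 2).
Local Notation s := hessian_parameter.

Lemma fraction_var_neq0 : t != 0.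
Proof. by rewrite tofrac_eq0 polyX_eq0. Qed.

Lemma fraction_natr_neq0 n : (n.+1%:R : M) != 0.
Proof. by rewrite -(rmorph_nat cst) fmorph_eq0 pnatr_eq0. Qed.

Lemma hessian_parameter_den_neq0 : 3 * t ^+ 2 != 0.
Proof.
apply: mulf_neq0; first exact: fraction_natr_neq0.
by apply: expf_neq0; exact: fraction_var_neq0.
Qed.

Let qE : tofrac q = - 3 * t ^+ 2.
Proof. by rewrite rmorphM rmorphXn rmorphN rmorph_nat /= rmorph_nat. Qed.

Let pE : tofrac p = t ^+ 3 + 108.
Proof. by rewrite rmorphD rmorphXn rmorph_nat /= rmorph_nat. Qed.

Let q0 : tofrac q != 0.
Proof.
by rewrite qE mulNr oppr_eq0; exact: hessian_parameter_den_neq0.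
Qed.

Let sE : tofrac q * s = tofrac p.
Proof.
rewrite pE qE !mulNr mulrAC; apply: (canLR opprK).
by apply: hessian_parameter_eq; exact: hessian_parameter_den_neq0.
Qed.

Let size_p : size p = 4%N.
Proof. by rewrite /p size_polyDl ?size_polyXn // size_polyC; case: eqP. Qed.

Let coprime_pq n : coprimep p (q ^+ n).
Proof.
apply: coprimep_expr; rewrite /q.
rewrite -polyCN mul_polyC coprimepZr ?oppr_eq0 ?pnatr_eq0 //.
rewrite /p; apply: coprimep_expr.
by rewrite coprimepX /root hornerD hornerXn hornerC expr0n add0r pnatr_eq0.
Qed.

Let s0 : s != 0.
Proof.
rewrite -(inj_eq (mulfI q0)) mulr0 sE tofrac_eq0 -size_poly_eq0 size_p //.
Qed.

Definition eval_hessian_parameter : {rmorphism {poly K} -> M} :=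
  horner_eval s \o map_poly cst.

Lemma eval_hessian_parameterX : eval_hessian_parameter 'X = s.
Proof. by rewrite /= /horner_eval map_polyX hornerX. Qed.

Lemma eval_hessian_parameterC a : eval_hessian_parameter a%:P = cst a.
Proof. by rewrite /= /horner_eval map_polyC hornerC. Qed.

Let poly_tail (n : {poly K}) : n = drop_poly 1 n * 'X + (n`_0)%:P.
Proof.
apply/polyP => -[|i]; rewrite coefD coefMX coefC /= ?add0r //.
by rewrite coef_drop_poly addn1 addr0.
Qed.

(** Multiplied by q^m, the value n(s) becomes a polynomial in t which modulo p
    only retains the constant coefficient of n, because q s = p. *)
Let clear_denominators m (n : {poly K}) : (size n <= m.+1)%N ->
  exists A, tofrac (q ^+ m) * eval_hessian_parameter n =
            tofrac (q ^+ m * (n`_0)%:P + p * A).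
Proof.
elim: m n => [|m IHm] n sz_n.
  exists 0; rewrite (size1_polyC sz_n) eval_hessian_parameterC.
  by rewrite mulr0 addr0 coefC expr0 rmorph1 !mul1r.
have [|A AE] := IHm (drop_poly 1 n).
  by rewrite size_drop_poly leq_subLR add1n.
exists (q ^+ m * ((drop_poly 1 n)`_0)%:P + p * A).
rewrite [in LHS](poly_tail n) rmorphD rmorphM.
rewrite eval_hessian_parameterX eval_hessian_parameterC.
rewrite mulrDr addrC rmorphD; congr (_ + _).
  by rewrite [in RHS]rmorphM.
rewrite exprSr rmorphM -mulrA [_ * s]mulrC [tofrac q * _]mulrA sE.
by rewrite mulrCA AE -rmorphM.
Qed.

(** That 1, t, t^2 are independent over K(s).  In a relation with coefficients
    n_i(s), clear denominators and reduce modulo p: since p is coprime to q, it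
    divides the sum of the n_i(0) t^i, whose degree is less than 3.  So all
    n_i(0) vanish, and the relation can be divided by s. *)
Lemma hessian_parameter_powers_free (n : 'I_3 -> {poly K}) :
  \sum_i eval_hessian_parameter (n i) * t ^+ i = 0 -> forall i, n i = 0.
Proof.
have : forall i, (size (n i) <= \max_i size (n i))%N.
  by move=> i; apply: (leq_bigmax i).
move: (\max_i size (n i)) => m.
elim: m n => [|m IHm] n sz_n.
  by move=> _ i; apply/eqP; rewrite -size_poly_leq0.
move=> n_rel.
have /fin_all_exists[A AE] i := clear_denominators (sz_n i).
pose r := \poly_(i < 3) (n (inord i))`_0.
have rE : r = \sum_(i < 3) ((n i)`_0)%:P * 'X^i.
  rewrite /r poly_def; apply: eq_bigr => i _.
  by rewrite mul_polyC inord_val.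
have p_r : p %| r.
  rewrite -(Gauss_dvdpr _ (coprime_pq m)) rE mulr_sumr.
  have -> : \sum_i q ^+ m * (((n i)`_0)%:P * 'X^i) = - p * \sum_i A i * 'X^i.
    apply/eqP; rewrite mulNr -addr_eq0 mulr_sumr -big_split /= -tofrac_eq0.
    rewrite rmorph_sum /=; apply/eqP.
    transitivity (tofrac (q ^+ m) *
        \sum_i eval_hessian_parameter (n i) * t ^+ i).
      rewrite mulr_sumr; apply: eq_bigr => i _.
      rewrite !mulrA -mulrDl rmorphM.
      congr (_ * _); last exact: rmorphXn.
      exact: esym (AE i).
    by rewrite n_rel mulr0.
  by rewrite mulNr dvdpNr dvdp_mulr.
have r0 : r = 0.
  apply/eqP; apply: contraTT p_r => r0; apply/negP => /(dvdp_leq r0).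
  by rewrite size_p => /leq_trans/(_ (size_poly _ _)).
have n0 i : (n i)`_0 = 0.
  have := congr1 (fun f : {poly K} => f`_i) r0.
  by rewrite coef_poly ltn_ord coef0 inord_val.
have dropE i : n i = drop_poly 1 (n i) * 'X.
  by rewrite {1}(poly_tail (n i)) n0 addr0.
suff drop0 : forall i, drop_poly 1 (n i) = 0.
  by move=> i; rewrite dropE drop0 mul0r.
apply: (IHm (fun i => drop_poly 1 (n i))) => [i|].
  by rewrite size_drop_poly leq_subLR add1n.
apply: (mulIf s0); rewrite mul0r -[RHS]n_rel mulr_suml.
apply: eq_bigr => i _; rewrite {2}dropE rmorphM.
by rewrite eval_hessian_parameterX mulrAC.
Qed.

Lemma hessian_parameter_lift : exists theta : {rmorphism M -> M},
  theta t = s /\ forall a, theta (cst a) = cst a.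
Proof.
have inj : injective eval_hessian_parameter.
  apply: raddf_inj => f f0.
  pose n (i : 'I_3) := if i == 0 then f else 0.
  apply: (@hessian_parameter_powers_free n _ 0).
  by apply: big1 => i _; rewrite /n; case: eqP => _; rewrite ?f0 ?rmorph0 mul0r.
have [theta thetaE] := fraction_lift inj; exists theta; split=> [|a].
  by rewrite thetaE eval_hessian_parameterX.
by rewrite thetaE eval_hessian_parameterC.
Qed.

Lemma hessian_parameter_basis (theta : {rmorphism M -> M}) :
    theta t = s -> (forall a, theta (cst a) = cst a) ->
  exists w : 'I_3 -> M, free_over theta w /\ forall y, in_span theta w y.
Proof.
move=> theta_t theta_cst; exists (fun i => t ^+ i).
have thetaE f : theta (tofrac f) = eval_hessian_parameter f.
  rewrite tofrac_horner -horner_map -map_poly_comp theta_t.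
  by rewrite (eq_map_poly (g := cst)).
have fw : free_over theta (fun i : 'I_3 => t ^+ i).
  move=> c c_rel; have [g [f [g0 cE]]] := common_denominator c.
  have f0 : forall i, f i = 0.
    apply: hessian_parameter_powers_free.
    apply: (mulfI (x := (theta (tofrac g))^-1)).
      by rewrite invr_eq0 fmorph_eq0 tofrac_eq0.
    rewrite mulr0 -[RHS]c_rel mulr_sumr; apply: eq_bigr => i _.
    by rewrite cE fmorph_div !thetaE mulrA [_^-1 * _]mulrC.
  by move=> i; rewrite cE f0 rmorph0 mul0r.
split=> //; apply: max_free_spans => // b' b'_free.
(* Since theta t = s, applying theta to the coefficients of P gives the cubic
   X^3 + 3s X^2 + 108 over theta(M) = K(s), of which t is a root. *)
pose P : {poly M} := 'X^3 + ((3 * t) *: 'X^2 + 108%:P).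
have szP : size P = 4%N.
  rewrite /P size_polyDl size_polyXn // ltnS.
  apply: leq_trans (size_polyD _ _) _; rewrite geq_max.
  rewrite (leq_trans (size_scale_leq _ _)) ?size_polyXn //=.
  by rewrite (leq_trans (size_polyC_leq1 _)).
have : (4 <= (size P).-1)%N.
  apply: (free_over_bound _ _ _ b'_free).
  - by move=> a; exists (cst a).
  - by rewrite -size_poly_eq0 szP.
  - rewrite /root map_cubic_horner rmorphM theta_t !rmorph_nat.
    rewrite /s hessian_parameter_eq; last exact: hessian_parameter_den_neq0.
    by rewrite opprD subrK subrr.
by rewrite szP.
Qed.

End CubicSubstitution.

(** * Multivariate polynomials over an infinite field *)

Section MmapMorphisms.
Variables (n : nat) (R : comNzRingType).

Lemma rmorph_mmap (S T : comNzRingType) (psi : {rmorphism S -> T})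
    (f : R -> S) (g : R -> T) (v : 'I_n -> S) (w : 'I_n -> T)
    (p : {mpoly R[n]}) :
    (forall c, psi (f c) = g c) -> (forall i, psi (v i) = w i) ->
  psi (mmap f v p) = mmap g w p.
Proof.
move=> fg vw; rewrite /mmap rmorph_sum; apply: eq_bigr => m _.
rewrite rmorphM fg /mmap1 rmorph_prod; congr (_ * _).
by apply: eq_bigr => i _; rewrite rmorphXn vw.
Qed.

Lemma eq_mmap (S : comNzRingType) (f : R -> S) (v w : 'I_n -> S)
    (p : {mpoly R[n]}) :
  v =1 w -> mmap f v p = mmap f w p.
Proof. by move=> vw; apply: (rmorph_mmap (psi := idfun)). Qed.

Lemma dhomog_mmap (S : comNzRingType) (f : R -> S) (c : S) (v : 'I_n -> S) d
    (p : {mpoly R[n]}) :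
  p \is d.-homog -> mmap f (fun i => c * v i) p = c ^+ d * mmap f v p.
Proof.
move=> p_hom; rewrite /mmap mulr_sumr big_seq [RHS]big_seq.
apply: eq_bigr => m mp; rewrite mulrCA; congr (_ * _).
rewrite /mmap1; under eq_bigr do rewrite exprMn.
rewrite big_split /=; congr (_ * _).
by rewrite prodrXr -mdegE (dhomog_mf p_hom).
Qed.

Lemma dhomog_meval (c : R) (v : 'I_n -> R) d (p : {mpoly R[n]}) :
  p \is d.-homog -> p.@[fun i => c * v i] = c ^+ d * p.@[v].
Proof. exact: dhomog_mmap. Qed.

Lemma mmap_map_mpoly (S T : comNzRingType) (phi : {rmorphism R -> S})
    (psi : {rmorphism S -> T}) (w : 'I_n -> T) (p : {mpoly R[n]}) :
  mmap psi w (map_mpoly phi p) = mmap (psi \o phi) w p.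
Proof.
apply: (rmorph_mmap (psi := mmap psi w)) => [c|i]; first by rewrite /= mmapC.
by rewrite /= mmapX mmap1U.
Qed.

End MmapMorphisms.

Section InfiniteField.
Variable K : numFieldType.

Lemma poly_eq0_by_eval (p : {poly K}) : (forall x, p.[x] = 0) -> p = 0.
Proof.
move=> p0; apply/eqP; apply/negPn/negP => pn0.
have := max_poly_roots pn0 (rs := [seq i%:R | i <- iota 0 (size p)]).
rewrite size_map size_iota ltnn => /(_ _ _)/notF; apply.
  by apply/allP => x _; rewrite /root p0.
by rewrite map_inj_uniq ?iota_uniq //; apply: mulrIn; exact: oner_neq0.
Qed.

Lemma mpoly_eq0_by_eval n (p : {mpoly K[n]}) : (forall v, p.@[v] = 0) -> p = 0.
Proof.
elim: n p => [|n IHn] p p0.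
  have := p0 (fun=> 0); rewrite (nvar0_mpolyC p) mevalC => ->.
  by rewrite mpolyC0.
pose q (w : 'I_n -> K) := map_poly (meval w) (muni p).
have muniE_eval w x :
    (q w).[x] = p.@[fun i => if unlift ord_max i is Some j then w j else x].
  rewrite /q muniE rmorph_sum horner_sum mevalE; apply: eq_bigr => m _ /=.
  rewrite map_polyZ map_polyXn hornerZ hornerXn /= mevalZ mevalX -mulrA.
  rewrite big_ord_recr /= unlift_none; congr (_ * (_ * _)).
  apply: eq_bigr => i _; rewrite mnmE (_ : widen_ord _ i = lift ord_max i).
    by rewrite liftK.
  by apply: val_inj; rewrite /= /bump leqNgt ltn_ord.
have muni0 : muni p = 0.
  apply/polyP => k; rewrite coef0; apply: IHn => w.
  have : q w = 0 by apply: poly_eq0_by_eval => x; rewrite muniE_eval p0.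
  by move/(congr1 (fun r : {poly K} => r`_k)); rewrite coef_map coef0.
apply/mpolyP => m; rewrite mcoeff0.
have : ((muni p)`_(m ord_max))@_[multinom m (widen_ord (leqnSn n) i) | i < n]
    = 0.
  by rewrite muni0 coef0 mcoeff0.
have -> : p@_m = \sum_(k <- msupp p) p@_k * (k == m)%:R.
  rewrite {1}[p]mpolyE raddf_sum; apply: eq_bigr => k _ /=.
  by rewrite mcoeffZ mcoeffX.
rewrite muniE coef_sum raddf_sum /= => sum0; rewrite -[RHS]sum0.
apply: eq_bigr => k _; rewrite coefZ coefXn.
have [->|ne_km] := eqVneq k m.
  by rewrite eqxx !mulr1 mcoeffZ mcoeffX eqxx mulr1.
have [max_km|_] := eqVneq (m ord_max) (k ord_max); last first.
  by rewrite !mulr0 mcoeff0.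
rewrite mulr1 mcoeffZ mcoeffX; case: eqP => // /mnmP km.
case/eqP: ne_km; apply/mnmP => i; case: (unliftP ord_max i) => [j ->|->] //.
have := km j; rewrite !mnmE (_ : widen_ord _ j = lift ord_max j) //.
by apply: val_inj; rewrite /= /bump leqNgt ltn_ord.
Qed.

Lemma dhomog_by_scaling n d (p : {mpoly K[n]}) :
  (forall c v, p.@[fun i => c * v i] = c ^+ d * p.@[v]) -> p \is d.-homog.
Proof.
move=> p_scale.
suff <- : pihomog mdeg d p = p by exact: pihomogP.
have pE := pihomog_partitionE (leq_addr d.+1 (mmeasure mdeg p)).
have pv c v : p.@[fun i => c * v i] =
    \sum_(e < mmeasure mdeg p + d.+1) c ^+ e * (pihomog mdeg e p).@[v].
  rewrite {1}pE raddf_sum; apply: eq_bigr => e _ /=.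
  exact/dhomog_meval/pihomogP.
apply/subr0_eq/mpoly_eq0_by_eval => v.
have : \poly_(e < mmeasure mdeg p + d.+1) (pihomog mdeg e p).@[v] =
    p.@[v] *: 'X^d.
  apply/subr0_eq/poly_eq0_by_eval => c.
  rewrite hornerD hornerN hornerZ hornerXn horner_poly.
  under eq_bigr do rewrite mulrC.
  by rewrite -pv p_scale mulrC subrr.
move=> /(congr1 (fun r : {poly K} => r`_d)).
rewrite coef_poly coefZ coefXn eqxx mulr1 ltn_addl // mevalB => ->.
by rewrite subrr.
Qed.

(** An infinitesimal criterion of density: through one point [p0] there are, in
    every direction [v], polynomial curves on which [f] vanishes.  If the
    expansion of [f] at [p0] had an initial form of degree d, then the
    coefficient of 'X^d along the curve of direction [v] would be the value of
    that form at [v]; so the initial form vanishes everywhere. *)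
Lemma mpoly_eq0_by_curves n (f : {mpoly K[n]}) (p0 : 'I_n -> K) :
    (forall v : 'I_n -> K, exists r : 'I_n -> {poly K},
       mmap polyC (fun i => (p0 i)%:P + 'X * ((v i)%:P + 'X * r i)) f = 0) ->
  f = 0.
Proof.
move=> curves.
pose g := f \mPo [tuple 'X_i + (p0 i)%:MP | i < n].
have gE (S : comNzRingType) (phi : {rmorphism K -> S}) w :
    mmap phi w g = mmap phi (fun i => w i + phi (p0 i)) f.
  rewrite /g /comp_mpoly.
  apply: (rmorph_mmap (psi := mmap phi w)) => [c|i]; first by rewrite /= mmapC.
  by rewrite tnth_mktuple /= mmapD mmapC mmapX mmap1U.
suff g0 : g = 0.
  apply: mpoly_eq0_by_eval => v.
  have := gE K idfun (fun i => v i - p0 i); rewrite g0 mmap0 => f0.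
  by rewrite [RHS]f0; apply: eq_mmap => i /=; rewrite subrK.
suff g_hom d : pihomog mdeg d g = 0.
  by rewrite (pihomog_partitionE (leqnn (mmeasure mdeg g))) big1.
elim/ltn_ind: d => d IHd; apply: mpoly_eq0_by_eval => v.
have [r r0] := curves v.
pose w i := (v i)%:P + 'X * r i : {poly K}.
have : mmap polyC (fun i => 'X * w i) g = 0.
  by rewrite gE -[RHS]r0; apply: eq_mmap => i; rewrite addrC.
rewrite {1}(pihomog_partitionE (leq_addr d.+1 (mmeasure mdeg g))) raddf_sum /=.
under eq_bigr do rewrite (dhomog_mmap _ _ _ (pihomogP _ _ _)).
move=> /(congr1 (fun q : {poly K} => q`_d)); rewrite coef_sum coef0.
(* The summand d.+1 in the bound only serves to make d one of the indices. *)
have dN : (d < mmeasure mdeg g + d.+1)%N by rewrite ltn_addl.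
rewrite (bigD1 (Ordinal dN)) //= big1 => [|e]; last first.
  rewrite -val_eqE coefXnM /= => ne_ed.
  have [//|le_ed] := ltnP d e; rewrite IHd ?mmap0 ?coef0 //.
  by rewrite ltn_neqAle ne_ed.
rewrite addr0 coefXnM ltnn subnn -horner_coef0 => w0.
transitivity (mmap polyC w (pihomog mdeg d g)).[0]; last exact: w0.
apply/esym.
apply: (rmorph_mmap (psi := horner_eval 0)) => [c|i].
  exact: hornerC.
by rewrite /= /horner_eval /w !hornerE.
Qed.

End InfiniteField.

(** * Ternary cubics over a commutative ring *)

Local Notation o0 := (@Ordinal 3 0 isT).
Local Notation o1 := (@Ordinal 3 1 isT).
Local Notation o2 := (@Ordinal 3 2 isT).

Lemma ord3P (P : 'I_3 -> Prop) : P o0 -> P o1 -> P o2 -> forall i, P i.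
Proof.
move=> P0 P1 P2 [[|[|[|//]]] lti]; rewrite (bool_irrelevance lti isT);
  by [exact: P0 | exact: P1 | exact: P2].
Qed.

Lemma sum3E (V : nmodType) (F : 'I_3 -> V) : \sum_i F i = F o0 + F o1 + F o2.
Proof.
rewrite !big_ord_recl big_ord0 addr0 addrA.
by congr (F _ + F _ + F _); apply: val_inj.
Qed.

Lemma prod3E (R : pzRingType) (F : 'I_3 -> R) :
  \prod_i F i = F o0 * F o1 * F o2.
Proof.
rewrite !big_ord_recl big_ord0 mulr1 mulrA.
by congr (F _ * F _ * F _); apply: val_inj.
Qed.

Lemma det2E (R : comPzRingType) (A : 'M[R]_2) :
  \det A = A 0 0 * A 1 1 - A 0 1 * A 1 0.
Proof.
rewrite (expand_det_row _ 0) !big_ord_recl big_ord0 /cofactor !det_mx11 !mxE /=.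
rewrite /bump /= expr0 expr1 mul1r mulN1r addr0 mulrN.
by congr (_ * A _ _ - A _ _ * A _ _); apply: val_inj.
Qed.

Lemma det3E (R : comPzRingType) (A : 'M[R]_3) :
  \det A = A o0 o0 * (A o1 o1 * A o2 o2 - A o1 o2 * A o2 o1)
         - A o0 o1 * (A o1 o0 * A o2 o2 - A o1 o2 * A o2 o0)
         + A o0 o2 * (A o1 o0 * A o2 o1 - A o1 o1 * A o2 o0).
Proof.
rewrite (expand_det_row _ o0) sum3E /cofactor !det2E !mxE /=.
rewrite expr0 expr1 expr2 mul1r !mulN1r opprK mulrN mul1r.
congr (_ * (A _ _ * A _ _ - A _ _ * A _ _)
       - _ * (A _ _ * A _ _ - A _ _ * A _ _)
       + _ * (A _ _ * A _ _ - A _ _ * A _ _)); exact: val_inj.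
Qed.

(** Forms, their Hessian and linear substitutions are needed over polynomial
    rings as well, for the generic cubic and for one-parameter families of
    cubics; hence the versions over a commutative ring of notions that are
    given over a field. *)
Section Forms.
Variable R : comNzRingType.

Definition cubic_form (v : 'I_10 -> R) : {mpoly R[3]} :=
  \sum_i v i *: 'X_[tnth cubic_monomials i].

Definition form_coefs (F : {mpoly R[3]}) (i : 'I_10) : R :=
  F@_(tnth cubic_monomials i).

Lemma cubic_monomials_inj : injective (tnth cubic_monomials).
Proof. by apply/tuple_uniqP. Qed.

Lemma cubic_formK v : form_coefs (cubic_form v) =1 v.
Proof.
move=> i; rewrite /form_coefs /cubic_form raddf_sum (bigD1 i) //= big1 ?addr0.
  by rewrite mcoeffZ mcoeffX eqxx mulr1.
move=> j ne_ji; rewrite mcoeffZ mcoeffX (inj_eq cubic_monomials_inj).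
by rewrite (negPf ne_ji) mulr0.
Qed.

Lemma mdeg_cubic_monomials i : mdeg (tnth cubic_monomials i) = 3.
Proof.
have /allP/(_ _ (mem_tnth i cubic_monomials))/eqP :
  all (fun m : 'X_{1..3} => mdeg m == 3) cubic_monomials; last by [].
by rewrite /= !mdegE !sum3E.
Qed.

Lemma mem_cubic_monomials (m : 'X_{1..3}) :
  mdeg m = 3 -> m \in cubic_monomials.
Proof.
rewrite mdegE sum3E => m3.
have -> : m = [multinom [tuple m o0; m o1; m o2]].
  by apply/mnmP; apply: ord3P.
move: (m o0) (m o1) (m o2) m3 => a b c.
case: a => [|[|[|[|a]]]]; case: b => [|[|[|[|b]]]];
  case: c => [|[|[|[|c]]]] //; lia.
Qed.

Lemma form_coefsK (F : {mpoly R[3]}) :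
  F \is 3.-homog -> cubic_form (form_coefs F) = F.
Proof.
move=> F_hom; apply/mpolyP => m.
have [/mem_cubic_monomials/tnthP[i ->]|m_deg] := eqVneq (mdeg m) 3.
  exact: cubic_formK.
rewrite (dhomog_nemf_coeff F_hom m_deg).
rewrite /cubic_form raddf_sum big1 // => i _ /=; rewrite mcoeffZ mcoeffX.
case: eqP => [mi|]; rewrite ?mulr0 //; case/eqP: m_deg; rewrite -mi.
exact: mdeg_cubic_monomials.
Qed.

Lemma cubic_formZ c v : cubic_form (fun i => c * v i) = c *: cubic_form v.
Proof.
by rewrite /cubic_form scaler_sumr; apply: eq_bigr => j _; rewrite scalerA.
Qed.

Lemma eq_cubic_form v w : v =1 w -> cubic_form v = cubic_form w.
Proof. by move=> vw; apply: eq_bigr => i _; rewrite vw. Qed.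

Lemma cubic_form_homog v : cubic_form v \is 3.-homog.
Proof.
apply: rpred_sum => i _; apply: rpredZ; rewrite dhomogX.
by apply/eqP; exact: mdeg_cubic_monomials.
Qed.

End Forms.

Section Derivatives.
Variable R : comNzRingType.
Implicit Types (F G : {mpoly R[3]}) (g : 'M[R]_3).

Definition hessian_mx F : 'M_3 := \matrix_(i, j) (F^`M(i))^`M(j).
Definition hessian_form F : {mpoly R[3]} := \det (hessian_mx F).
Definition subst_form g F : {mpoly R[3]} :=
  F \mPo [tuple \sum_j g i j *: 'X_j | i < 3].

Lemma subst_formX g i : subst_form g 'X_i = \sum_j g i j *: 'X_j.
Proof. by rewrite /subst_form comp_mpolyXU -tnth_nth tnth_mktuple. Qed.

Lemma subst_formM g F G :
  subst_form g (F * G) = subst_form g F * subst_form g G.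
Proof. by rewrite /subst_form rmorphM. Qed.

Lemma mderivXU (i j : 'I_3) : ('X_i : {mpoly R[3]})^`M(j) = (i == j)%:R.
Proof.
rewrite mderivX mnm1E; case: eqP => [->|_]; last by rewrite scale0r.
have -> : (U_(j) - U_(j) = 0 :> 'X_{1..3})%MM.
  by apply/mnmP => k; rewrite mnmBE subnn mnm0E.
by rewrite mpolyX0 scale1r.
Qed.

Lemma mderiv1 (i : 'I_3) : (1 : {mpoly R[3]})^`M(i) = 0.
Proof. by rewrite -mpolyC1 mderivC. Qed.

(** The chain rule.  Both sides are linear in [F] and satisfy the same Leibniz
    rule, so it suffices to compare them on the variables. *)
Lemma mderiv_subst g F i :
  (subst_form g F)^`M(i) = \sum_k g k i *: subst_form g F^`M(k).
Proof.
pose P F := forall i,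
  (subst_form g F)^`M(i) = \sum_k g k i *: subst_form g F^`M(k).
have P1 : P 1.
  move=> j; rewrite /subst_form rmorph1 mderiv1 big1 // => k _.
  by rewrite mderiv1 rmorph0 scaler0.
have PX j : P 'X_j.
  move=> k; rewrite subst_formX raddf_sum /=.
  under eq_bigr do rewrite mderivZ mderivXU.
  under [RHS]eq_bigr do rewrite mderivXU /subst_form rmorph_nat.
  rewrite (bigD1 k) //= eqxx big1 => [|l /negPf->]; last by rewrite scaler0.
  rewrite (bigD1 j) //= eqxx [in RHS]big1 => [//|l].
  by rewrite eq_sym => /negPf->; rewrite scaler0.
have PM G H : P G -> P H -> P (G * H).
  move=> PG PH j; rewrite subst_formM mderivM PG PH mulr_suml mulr_sumr.
  rewrite -big_split.
  apply: eq_bigr => k _ /=; rewrite mderivM /subst_form rmorphD !rmorphM /=.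
  by rewrite scalerDr -scalerAl -scalerAr.
have PXm m : P 'X_[m].
  rewrite mpolyXE_id; apply: (big_ind P) => // j _.
  by elim: (m j) => [|d IHd]; rewrite ?expr0 // exprS; apply: PM.
move: i; change (P F).
rewrite [F]mpolyE; apply: (big_ind P) => [j|G H PG PH j|m _ j].
- rewrite /subst_form rmorph0 mderiv0 big1 // => k _.
  by rewrite mderiv0 rmorph0 scaler0.
- rewrite /subst_form rmorphD mderivD [in LHS]PG [in LHS]PH -big_split.
  by apply: eq_bigr => k _ /=; rewrite mderivD /subst_form rmorphD scalerDr.
- rewrite /subst_form comp_mpolyZ mderivZ [in LHS]PXm scaler_sumr.
  apply: eq_bigr => k _ /=; rewrite mderivZ /subst_form comp_mpolyZ.
  by rewrite !scalerA mulrC.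
Qed.

Lemma hessian_mx_subst g F :
  hessian_mx (subst_form g F) =
  (map_mx (@mpolyC 3 R) g)^T *m map_mx (subst_form g) (hessian_mx F)
    *m map_mx (@mpolyC 3 R) g.
Proof.
apply/matrixP => i j; rewrite !mxE mderiv_subst raddf_sum /=.
under [RHS]eq_bigr do rewrite !mxE mulr_suml.
rewrite exchange_big; apply: eq_bigr => k _ /=.
rewrite mderivZ mderiv_subst scaler_sumr; apply: eq_bigr => l _.
by rewrite !mxE [RHS]mulrC !mul_mpolyC !scalerA mulrC.
Qed.

Lemma hessian_form_subst g F :
  hessian_form (subst_form g F) =
  (\det g) ^+ 2 *: subst_form g (hessian_form F).
Proof.
rewrite /hessian_form hessian_mx_subst !det_mulmx det_tr !det_map_mx.
by rewrite mulrAC -expr2 -rmorphXn /= mul_mpolyC.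
Qed.

Lemma hessian_formZ c F : hessian_form (c *: F) = c ^+ 3 *: hessian_form F.
Proof.
rewrite /hessian_form -[RHS]mul_mpolyC rmorphXn /= -detZ; congr (\det _).
by apply/matrixP => i j; rewrite !mxE !mderivZ mul_mpolyC.
Qed.

Lemma scalar_subst_cubic c g F : F \is 3.-homog ->
  subst_form (c *: g) F = c ^+ 3 *: subst_form g F.
Proof.
move=> F_hom; rewrite -[RHS]mul_mpolyC rmorphXn /= /subst_form /comp_mpoly.
rewrite -(dhomog_mmap _ _ _ F_hom); apply: eq_mmap => i.
rewrite !tnth_mktuple mul_mpolyC scaler_sumr; apply: eq_bigr => j _.
by rewrite mxE scalerA.
Qed.

End Derivatives.

Section Functoriality.
Variables (R S : comNzRingType) (phi : {rmorphism R -> S}).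

Lemma map_mpolyXU i : map_mpoly phi ('X_i : {mpoly R[3]}) = 'X_i.
Proof. exact: map_mpolyX. Qed.

Lemma map_mderiv (F : {mpoly R[3]}) i :
  map_mpoly phi F^`M(i) = (map_mpoly phi F)^`M(i).
Proof.
apply/mpolyP => m; rewrite mcoeff_map_mpoly !mcoeff_deriv mcoeff_map_mpoly.
by rewrite raddfMn.
Qed.

Lemma map_hessian_mx F :
  map_mx (map_mpoly phi) (hessian_mx F) = hessian_mx (map_mpoly phi F).
Proof. by apply/matrixP => i j; rewrite !mxE !map_mderiv. Qed.

Lemma map_hessian_form F :
  map_mpoly phi (hessian_form F) = hessian_form (map_mpoly phi F).
Proof. by rewrite /hessian_form -det_map_mx map_hessian_mx. Qed.

Lemma map_subst_form g F :
  map_mpoly phi (subst_form g F) = subst_form (map_mx phi g) (map_mpoly phi F).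
Proof.
rewrite /subst_form /comp_mpoly.
rewrite [RHS]mmap_map_mpoly.
apply: (rmorph_mmap (psi := map_mpoly phi)) => [c|i].
  by rewrite /= map_mpolyC.
rewrite !tnth_mktuple raddf_sum; apply: eq_bigr => j _ /=.
by rewrite map_mpolyZ map_mpolyXU mxE.
Qed.

Lemma map_cubic_form v : map_mpoly phi (cubic_form v) = cubic_form (phi \o v).
Proof.
rewrite /cubic_form raddf_sum; apply: eq_bigr => i _ /=.
by rewrite map_mpolyZ map_mpolyX.
Qed.

Lemma map_form_coefs F i :
  phi (form_coefs F i) = form_coefs (map_mpoly phi F) i.
Proof. by rewrite /form_coefs mcoeff_map_mpoly. Qed.

End Functoriality.

(** * The Hesse pencil *)

Section HessePencil.
Variable R : comNzRingType.

Definition hesse_coefs (a b : R) (i : 'I_10) : R :=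
  if (i < 3)%N then a else if i == 9 :> nat then b else 0.

Lemma hesse_coefsZ c a b i :
  c * hesse_coefs a b i = hesse_coefs (c * a) (c * b) i.
Proof. by rewrite /hesse_coefs; do 2?case: ifP => // _; rewrite mulr0. Qed.

Definition hesse_form a b : {mpoly R[3]} := cubic_form (hesse_coefs a b).

Lemma cubic_formE (v : 'I_10 -> R) (x := 'X_o0) (y := 'X_o1) (z := 'X_o2) :
  cubic_form v =
    v (inord 0) *: x ^+ 3 + v (inord 1) *: y ^+ 3 + v (inord 2) *: z ^+ 3
  + v (inord 3) *: (x ^+ 2 * y) + v (inord 4) *: (x ^+ 2 * z)
  + v (inord 5) *: (x * y ^+ 2) + v (inord 6) *: (y ^+ 2 * z)
  + v (inord 7) *: (x * z ^+ 2) + v (inord 8) *: (y * z ^+ 2)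
  + v (inord 9) *: (x * y * z).
Proof.
rewrite /cubic_form.
have monE (m : 'X_{1..3}) :
    'X_[m] = x ^+ m o0 * y ^+ m o1 * z ^+ m o2 :> {mpoly R[3]}.
  by rewrite mpolyXE_id prod3E.
under eq_bigr do rewrite monE.
(* The exponents of the monomials, listed in the order of cubic_monomials. *)
have -> : \sum_(i < 10) v i *: (x ^+ tnth cubic_monomials i o0
      * y ^+ tnth cubic_monomials i o1 * z ^+ tnth cubic_monomials i o2) =
    \sum_(i <- [:: (0, (3, 0, 0)); (1, (0, 3, 0)); (2, (0, 0, 3));
      (3, (2, 1, 0)); (4, (2, 0, 1)); (5, (1, 2, 0)); (6, (0, 2, 1));
      (7, (1, 0, 2)); (8, (0, 1, 2)); (9, (1, 1, 1))]%N) v (inord i.1) *: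
      (x ^+ i.2.1.1 * y ^+ i.2.1.2 * z ^+ i.2.2).
  rewrite !big_cons big_nil !big_ord_recl big_ord0.
  by do 10?[congr (_ + _)]; congr (v _ *: _); apply: val_inj; rewrite /= inordK.
rewrite !big_cons big_nil /= addr0 !addrA.
by do 9?[congr (_ + _)]; congr (_ *: _); rewrite ?expr0 ?expr1 ?mulr1 ?mul1r.
Qed.

Lemma hesse_formE a b (x := 'X_o0) (y := 'X_o1) (z := 'X_o2) :
  hesse_form a b = a *: (x ^+ 3 + y ^+ 3 + z ^+ 3) + b *: (x * y * z).
Proof.
rewrite /hesse_form cubic_formE /hesse_coefs !inordK //= !scale0r !addr0.
by rewrite !scalerDr.
Qed.

(** With cyclic indices i, next3 i, next3 (next3 i), the derivatives of a Hesse
    form have one formula for all i, and cofactors carry no signs. *)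
Definition next3 (i : 'I_3) : 'I_3 :=
  match val i with 0 => o1 | 1 => o2 | _ => o0 end.

Lemma mderiv_hesse_form a b i :
  (hesse_form a b)^`M(i) =
  (3%:R * a)%:MP * 'X_i ^+ 2 + b%:MP * ('X_(next3 i) * 'X_(next3 (next3 i))).
Proof.
have dX3 (j k : 'I_3) :
    ('X_j ^+ 3 : {mpoly R[3]})^`M(k) = (j == k)%:R * 3%:R * 'X_j ^+ 2.
  by rewrite exprS expr2 !mderivM mderivXU; ring.
rewrite hesse_formE !(mderivD, mderivZ, mderivM, dX3, mderivXU).
by move: i; apply: ord3P; rewrite /= -!mul_mpolyC; ring.
Qed.

Lemma hessian_mx_hesse_form a b i j :
  hessian_mx (hesse_form a b) i j =
  (6%:R * a)%:MP * (i == j)%:R * 'X_i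
  + b%:MP * ((next3 i == j)%:R * 'X_(next3 (next3 i))
             + (next3 (next3 i) == j)%:R * 'X_(next3 i)).
Proof.
rewrite mxE mderiv_hesse_form mderivD !mderiv_mulC expr2 !mderivM !mderivXU.
ring.
Qed.

(** The pencil is stable under the Hessian, which induces on it a map of
    degree 3 in (a : b). *)
Lemma hessian_hesse_form a b :
  hessian_form (hesse_form a b) =
  hesse_form (- 6%:R * a * b ^+ 2) (216%:R * a ^+ 3 + 2%:R * b ^+ 3).
Proof.
rewrite [RHS]hesse_formE /hessian_form det3E !hessian_mx_hesse_form /=.
by rewrite -!mul_mpolyC; ring.
Qed.

End HessePencil.

Lemma map_hesse_coefs (R S : comNzRingType) (phi : {rmorphism R -> S}) a b i :
  phi (hesse_coefs a b i) = hesse_coefs (phi a) (phi b) i.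
Proof. by rewrite /hesse_coefs; do 2?case: ifP => // _; rewrite rmorph0. Qed.

(** * The Aronhold invariant of degree 4 *)

Section Trace.
Variable R : comNzRingType.

Lemma mxtrace_lin_mx m n (f : {linear 'M[R]_(m, n) -> 'M[R]_(m, n)}) :
  \tr (lin_mx f) = \sum_i \sum_j f (delta_mx i j) i j.
Proof.
rewrite /mxtrace (reindex _ (curry_mxvec_bij _ _)) /= pair_bigA.
apply: eq_bigr => -[i j] _ /=.
by rewrite !mxE /= vec_mx_delta mxvecE.
Qed.

(** Both sides are traces of endomorphisms of the space of square matrices, and
    the left-hand one is [f] conjugated by Q |-> g Q g^T. *)
Lemma mxtrace_conj n (g h : 'M[R]_n) (f : {linear 'M[R]_n -> 'M[R]_n}) :
  h *m g = 1%:M ->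
  \sum_i \sum_j (h *m f (g *m delta_mx i j *m g^T) *m h^T) i j =
  \sum_i \sum_j f (delta_mx i j) i j.
Proof.
move=> hg1.
pose G := mulmx g \o mulmxr g^T : {linear 'M[R]_n -> 'M[R]_n}.
pose H := mulmx h \o mulmxr h^T : {linear 'M[R]_n -> 'M[R]_n}.
transitivity (\tr (lin_mx (H \o (f \o G)))).
  rewrite mxtrace_lin_mx; apply: eq_bigr => i _; apply: eq_bigr => j _ /=.
  by rewrite /mulmxr !mulmxA.
have lin_comp (u v : {linear 'M[R]_n -> 'M[R]_n}) :
    lin_mx (u \o v) = lin_mx v *m lin_mx u.
  apply/row_matrixP => i; rewrite !rowE mulmxA.
  by rewrite !mul_rV_lin mxvecK.
have GH1 : lin_mx H *m lin_mx G = 1%:M.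
  rewrite -lin_comp; apply/row_matrixP => i; rewrite !rowE mul_rV_lin mulmx1 /=.
  rewrite /mulmxr !mulmxA (mulmx1C hg1) mul1mx -mulmxA -trmx_mul (mulmx1C hg1).
  by rewrite trmx1 mulmx1 vec_mxK.
rewrite (lin_comp H (f \o G)) (lin_comp f G) -mxtrace_lin_mx mxtrace_mulC.
by rewrite mulmxA GH1 mul1mx.
Qed.

End Trace.

Lemma sum2_scalemxE (R : comNzRingType) (I J : finType) m n
    (c : I -> J -> R) (B : I -> J -> 'M[R]_(m, n)) i j :
  (\sum_k \sum_l c k l *: B k l) i j = \sum_k \sum_l c k l * B k l i j.
Proof.
rewrite summxE; apply: eq_bigr => k _; rewrite summxE.
by apply: eq_bigr => l _; rewrite mxE.
Qed.

Section Pairing.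
Variable R : comNzRingType.
Implicit Types (A B g h : 'M[R]_3).

(** The polarization of the adjugate: the bilinear map with
    mixed_adj A A = 2 adj A. *)
Definition mixed_adj A B : 'M[R]_3 := \matrix_(i, j)
  (A (next3 j) (next3 i) * B (next3 (next3 j)) (next3 (next3 i))
   + B (next3 j) (next3 i) * A (next3 (next3 j)) (next3 (next3 i))
   - A (next3 j) (next3 (next3 i)) * B (next3 (next3 j)) (next3 i)
   - B (next3 j) (next3 (next3 i)) * A (next3 (next3 j)) (next3 i)).

(** The adjugate, in the indexing of [mixed_adj]. *)
Definition adj3 A : 'M[R]_3 := \matrix_(i, j)
  (A (next3 j) (next3 i) * A (next3 (next3 j)) (next3 (next3 i))
   - A (next3 j) (next3 (next3 i)) * A (next3 (next3 j)) (next3 i)).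

Lemma mul_adj3 A : adj3 A *m A = (\det A)%:M.
Proof.
apply/matrixP => i j; rewrite det3E !mxE sum3E !mxE.
by move: i j; do 2![apply: ord3P]; rewrite /= ?mulr1n ?mulr0n; ring.
Qed.

(** This is the Cauchy-Binet formula for the 2 x 2 minors, polarized. *)
Lemma mixed_adjMr A B g :
  mixed_adj (A *m g) (B *m g) = adj3 g *m mixed_adj A B.
Proof.
by apply/matrixP => i j; rewrite !mxE !sum3E !mxE /=; ring.
Qed.

Lemma trmx_mixed_adj A B : (mixed_adj A B)^T = mixed_adj A^T B^T.
Proof. by apply/matrixP => i j; rewrite !mxE; ring. Qed.

Lemma mixed_adj_congr A B g :
  mixed_adj (g^T *m A *m g) (g^T *m B *m g) =
  adj3 g *m mixed_adj A B *m (adj3 g)^T.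
Proof.
rewrite mixed_adjMr -mulmxA; congr (_ *m _); apply: trmx_inj.
by rewrite trmx_mul trmxK !trmx_mixed_adj !trmx_mul !trmxK mixed_adjMr.
Qed.

Lemma mixed_adj_sum (A B : 'I_3 -> 'M[R]_3) (a b : 'I_3 -> R) :
  mixed_adj (\sum_k a k *: A k) (\sum_l b l *: B l) =
  \sum_k \sum_l (a k * b l) *: mixed_adj (A k) (B l).
Proof.
by apply/matrixP => i j; rewrite !sum3E !mxE; ring.
Qed.

Lemma mixed_adjZ c A B :
  mixed_adj (c *: A) (c *: B) = c ^+ 2 *: mixed_adj A B.
Proof. by apply/matrixP => i j; rewrite !mxE; ring. Qed.

Variable A : 'I_3 -> 'M[R]_3.

(** For the trilinear form of a cubic, given by its slices [A k], this is an
    endomorphism of the space of 3 x 3 matrices, quadratic in the cubic and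
    equivariant: indices of [mixed_adj (A k) (A l)] transform contragrediently
    to [k] and [l]. *)
Definition polar_op (Q : 'M[R]_3) : 'M[R]_3 :=
  \sum_k \sum_l Q k l *: mixed_adj (A k) (A l).

Lemma polar_op_is_linear : linear polar_op.
Proof.
move=> c P Q; rewrite /polar_op scaler_sumr -big_split; apply: eq_bigr => k _.
rewrite scaler_sumr -big_split; apply: eq_bigr => l _ /=.
by rewrite !mxE scalerDl scalerA.
Qed.

HB.instance Definition _ :=
  GRing.isLinear.Build R _ _ _ polar_op polar_op_is_linear.

Lemma polar_op_delta i j : polar_op (delta_mx i j) = mixed_adj (A i) (A j).
Proof.
rewrite /polar_op (bigD1 i) //= (bigD1 j) //= big1 ?addr0 => [|l /negPf nl].
  rewrite big1 ?addr0 => [|k /negPf nk].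
    by rewrite mxE !eqxx scale1r.
  by rewrite big1 // => l _; rewrite mxE nk scale0r.
by rewrite mxE nl andbF scale0r.
Qed.

(** The trace of the square of [polar_op]. *)
Definition polar_trace : R :=
  \sum_i \sum_j polar_op (polar_op (delta_mx i j)) i j.

End Pairing.

(** The substitution [g] replaces [polar_op] by its conjugate under
    Q |-> g Q g^T, which leaves the trace of the square unchanged. *)
Lemma polar_trace_subst (R : comNzRingType) (A : 'I_3 -> 'M[R]_3)
    (g : 'M[R]_3) :
  \det g = 1 ->
  polar_trace (fun k => \sum_m g m k *: (g^T *m A m *m g)) = polar_trace A.
Proof.
move=> g1; set A' := fun k => _; pose h := adj3 g.
have hg : h *m g = 1%:M by rewrite mul_adj3 g1.
have gh : g *m h = 1%:M by exact: mulmx1C.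
have opE Q : polar_op A' Q = h *m polar_op A (g *m Q *m g^T) *m h^T.
  rewrite /polar_op /A'.
  pose E m n := h *m mixed_adj (A m) (A n) *m h^T.
  transitivity (\sum_m \sum_n (g *m Q *m g^T) m n *: E m n); last first.
    rewrite mulmx_sumr mulmx_suml; apply: eq_bigr => m _.
    rewrite mulmx_sumr mulmx_suml; apply: eq_bigr => n _.
    by rewrite -scalemxAr -scalemxAl.
  under eq_bigr do under eq_bigr do rewrite mixed_adj_sum.
  have EE m n : mixed_adj (g^T *m A m *m g) (g^T *m A n *m g) = E m n.
    exact: mixed_adj_congr.
  under eq_bigr do under eq_bigr do under eq_bigr do under eq_bigr do
    rewrite EE.
  (* With E opaque, the entries of its values are atoms for the final ring. *)
  clearbody E; apply/matrixP => i j.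
  rewrite !sum2_scalemxE.
  under eq_bigr do under eq_bigr do rewrite sum2_scalemxE.
  under [RHS]eq_bigr do under eq_bigr do rewrite !mxE sum3E !mxE !sum3E.
  rewrite !sum3E; ring.
rewrite -[RHS](mxtrace_conj (polar_op A \o polar_op A) hg).
apply: eq_bigr => i _; apply: eq_bigr => j _; rewrite !opE /= !mulmxA.
by rewrite gh mul1mx -!mulmxA -trmx_mul gh trmx1 mulmx1.
Qed.

Section Aronhold.
Variable R : comNzRingType.
Implicit Types (F : {mpoly R[3]}) (g : 'M[R]_3).

(** The slices of the symmetric trilinear form of a cubic: third derivatives of
    a cubic are constants, read off at the origin. *)
Definition third_mx F (k : 'I_3) : 'M[R]_3 :=
  \matrix_(i, j) ((hessian_mx F i j)^`M(k)).@[fun=> 0].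

(** Up to a constant factor, the Aronhold invariant S of degree 4. *)
Definition aronhold F : R := polar_trace (third_mx F).

Lemma meval0_subst_form g F :
  (subst_form g F).@[fun=> 0] = F.@[fun=> 0].
Proof.
rewrite /subst_form comp_mpoly_meval; apply: meval_eq => i.
rewrite tnth_mktuple raddf_sum big1 // => j _ /=.
by rewrite mevalZ mevalXU mulr0.
Qed.

Lemma third_mx_subst g F k :
  third_mx (subst_form g F) k = \sum_m g m k *: (g^T *m third_mx F m *m g).
Proof.
apply/matrixP => i j; rewrite mxE hessian_mx_subst.
have -> : ((map_mx (@mpolyC 3 R) g)^T *m map_mx (subst_form g) (hessian_mx F)
    *m map_mx (@mpolyC 3 R) g) i j =
    \sum_b \sum_a (g a i * g b j) *: subst_form g (hessian_mx F a b).
  rewrite mxE; apply: eq_bigr => b _; rewrite mxE mulr_suml.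
  apply: eq_bigr => a _; rewrite !mxE mulrAC -rmorphM /=.
  by rewrite mul_mpolyC.
have deriv0_sum (c : 'I_3 -> R) (P : 'I_3 -> {mpoly R[3]}) :
    ((\sum_l c l *: P l)^`M(k)).@[fun=> 0] =
    \sum_l c l * ((P l)^`M(k)).@[fun=> 0].
  have -> : (\sum_l c l *: P l)^`M(k) = \sum_l c l *: (P l)^`M(k).
    by rewrite raddf_sum; apply: eq_bigr => l _ /=; rewrite mderivZ.
  by rewrite raddf_sum; apply: eq_bigr => l _ /=; rewrite mevalZ.
have deriv0_subst P : ((subst_form g P)^`M(k)).@[fun=> 0] =
    \sum_l g l k * (P^`M(l)).@[fun=> 0].
  rewrite mderiv_subst raddf_sum; apply: eq_bigr => l _ /=.
  by rewrite mevalZ meval0_subst_form.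
under eq_bigr do under eq_bigr do rewrite mulrC -scalerA.
under eq_bigr do rewrite -scaler_sumr.
rewrite deriv0_sum; under eq_bigr do rewrite deriv0_sum.
under eq_bigr do under eq_bigr do rewrite deriv0_subst.
rewrite summxE.
have foldE a b l : ((hessian_mx F a b)^`M(l)).@[fun=> 0] = third_mx F l a b.
  by rewrite [RHS]mxE.
under eq_bigr do under eq_bigr do under eq_bigr do rewrite foldE.
move: (third_mx F) => T.
by rewrite !sum3E !mxE !sum3E !mxE !sum3E !mxE; ring.
Qed.

Lemma aronhold_subst g F : \det g = 1 -> aronhold (subst_form g F) = aronhold F.
Proof.
move=> g1; rewrite /aronhold -(polar_trace_subst (third_mx F) g1).
rewrite /polar_trace; apply: eq_bigr => i _; apply: eq_bigr => j _.
suff opE Q : polar_op (third_mx (subst_form g F)) Q = polar_op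
  (fun k => \sum_m g m k *: (g^T *m third_mx F m *m g)) Q by rewrite !opE.
rewrite /polar_op; apply: eq_bigr => k _; apply: eq_bigr => l _.
by rewrite !third_mx_subst.
Qed.

Lemma aronholdZ c F : aronhold (c *: F) = c ^+ 4 * aronhold F.
Proof.
have thirdZ k : third_mx (c *: F) k = c *: third_mx F k.
  by apply/matrixP => i j; rewrite !mxE !mderivZ mevalZ.
have opZ Q : polar_op (third_mx (c *: F)) Q = c ^+ 2 *: polar_op (third_mx F) Q.
  rewrite /polar_op scaler_sumr; apply: eq_bigr => k _.
  rewrite scaler_sumr; apply: eq_bigr => l _; rewrite !thirdZ mixed_adjZ.
  by rewrite !scalerA mulrC.
rewrite /aronhold /polar_trace mulr_sumr; apply: eq_bigr => i _.
rewrite mulr_sumr; apply: eq_bigr => j _.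
by rewrite !opZ linearZ scalerA mxE -exprD.
Qed.

(** In the coordinates of the pencil this is b (b^3 - 216 a^3) up to a factor:
    zero on the Fermat cubic (b = 0), nonzero on the triangle xyz (a = 0). *)
Lemma aronhold_hesse_form a b :
  aronhold (hesse_form a b) = 24%:R * b * (b ^+ 3 - 216%:R * a ^+ 3).
Proof.
have thirdE k i j : third_mx (hesse_form a b) k i j =
    6%:R * a * ((i == j) && (i == k))%:R
    + b * (((next3 i == j) && (next3 (next3 i) == k))%:R
           + ((next3 (next3 i) == j) && (next3 i == k))%:R).
  rewrite mxE hessian_mx_hesse_form.
  rewrite -!mulrA !mderivD !mderiv_mulC !mderivD.
  have mderiv_bool (c : bool) l :
      (c%:R * 'X_l : {mpoly R[3]})^`M(k) = (c && (l == k))%:R.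
    by case: c; rewrite ?mul1r ?mul0r ?mderivXU ?mderiv0.
  have meval_bool (c : bool) v : (c%:R : {mpoly R[3]}).@[v] = c%:R.
    by rewrite rmorph_nat.
  rewrite !mderiv_bool mevalD !mevalM mevalD !mevalC !meval_bool.
  by rewrite mulrA.
rewrite /aronhold /polar_trace.
under eq_bigr do under eq_bigr do rewrite polar_op_delta.
move: (third_mx _) thirdE => T TE.
under eq_bigr do under eq_bigr do rewrite /polar_op sum2_scalemxE.
have mixedE k l i j : mixed_adj (T k) (T l) i j =
    if k == l then
      if (i == k) && (j == k) then - 2%:R * b ^+ 2
      else if [&& i != j, i != k & j != k] then - 12%:R * a * b else 0
    else if [&& i == j, i != k & i != l] then 36%:R * a ^+ 2
    else if ((i == k) && (j == l)) || ((i == l) && (j == k)) then b ^+ 2 else 0.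
  by move: k l i j; do 4!apply: ord3P; rewrite mxE /= !TE /=; ring.
under eq_bigr do under eq_bigr do under eq_bigr do under eq_bigr do
  rewrite !mixedE.
rewrite !sum3E /=.
ring.
Qed.

End Aronhold.

Section AronholdMap.
Variables (R S : comNzRingType) (phi : {rmorphism R -> S}).

Lemma map_mixed_adj A B :
  map_mx phi (mixed_adj A B) = mixed_adj (map_mx phi A) (map_mx phi B).
Proof. by apply/matrixP => i j; rewrite !mxE !(rmorphB, rmorphD, rmorphM). Qed.

Lemma map_aronhold F : phi (aronhold F) = aronhold (map_mpoly phi F).
Proof.
have map_third k : map_mx phi (third_mx F k) = third_mx (map_mpoly phi F) k.
  apply/matrixP => i j; rewrite !mxE -!map_mderiv.
  rewrite /meval (mmap_map_mpoly phi idfun).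
  by apply: rmorph_mmap => // l; rewrite rmorph0.
have map_op Q : map_mx phi (polar_op (third_mx F) Q) =
    polar_op (third_mx (map_mpoly phi F)) (map_mx phi Q).
  rewrite /polar_op raddf_sum; apply: eq_bigr => k _.
  rewrite raddf_sum; apply: eq_bigr => l _ /=.
  by rewrite map_mxZ map_mixed_adj !map_third mxE.
rewrite /aronhold /polar_trace rmorph_sum; apply: eq_bigr => i _.
rewrite rmorph_sum; apply: eq_bigr => j _ /=.
by rewrite -(map_delta_mx phi) -!map_op mxE.
Qed.

End AronholdMap.

(** * Invariants are determined by their restriction to the Hesse pencil *)

Section Density.
Variable K : numClosedFieldType.

Lemma hessianE (F : {mpoly K[3]}) : hessian F = hessian_form F.
Proof. by []. Qed.

Lemma lin_substE g (F : {mpoly K[3]}) : lin_subst g F = subst_form g F.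
Proof. by []. Qed.

(** A matrix g is a scalar matrix c, with c^3 = det g, times an element of
    SL(3), and the scalar c acts on cubics as multiplication by det g. *)
Lemma invariant_lin_subst (I : {mpoly K[10]}) d g (F : {mpoly K[3]}) :
    I \is d.-homog -> SL3_invariant I -> F \is 3.-homog -> \det g != 0 ->
  I.@[coefs (lin_subst g F)] = (\det g) ^+ d * I.@[coefs F].
Proof.
move=> I_hom I_inv F_hom g0; pose c := 3.-root (\det g).
have c3 : c ^+ 3 = \det g by rewrite rootCK.
have c0 : c != 0 by apply: contraNneq g0 => c0; rewrite -c3 c0 expr0n.
pose g' := c^-1 *: g.
have g'1 : \det g' = 1 by rewrite detZ exprVn c3 mulVf.
have -> : lin_subst g F = (\det g) *: lin_subst g' F.
  have gE : g = c *: g' by rewrite scalerA divff // scale1r.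
  by rewrite !lin_substE {1}gE scalar_subst_cubic // c3.
rewrite -(I_inv _ _ g'1 F_hom) -(dhomog_meval _ _ I_hom).
by apply: meval_eq => i; rewrite /coefs mcoeffZ.
Qed.

Lemma curve_expansion (P : comNzRingType) (e b x y z m0 m1 m2 : P) :
  (x + e * m0) ^+ 3 + (y + e * m1) ^+ 3 + (z + e * m2) ^+ 3
    + e * b * ((x + e * m0) * (y + e * m1) * (z + e * m2)) =
  x ^+ 3 + y ^+ 3 + z ^+ 3
  + e * (x ^+ 2 * (3%:R * m0) + y ^+ 2 * (3%:R * m1) + z ^+ 2 * (3%:R * m2)
         + b * (x * y * z)
         + e * (3%:R * x * m0 ^+ 2 + e * m0 ^+ 3
                + 3%:R * y * m1 ^+ 2 + e * m1 ^+ 3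
                + 3%:R * z * m2 ^+ 2 + e * m2 ^+ 3
                + b * (m0 * y * z + x * m1 * z + x * y * m2
                       + e * (m0 * m1 * z + m0 * y * m2 + x * m1 * m2)
                       + e ^+ 2 * m0 * m1 * m2))).
Proof. ring. Qed.

(** The cubic monomials other than xyz are the products x_i^2 x_j; entry (i, j)
    of the table is the index of x_i^2 x_j in the list of monomials. *)
Definition tangent_coef (v : 'I_10 -> K) (i j : 'I_3) : K :=
  v (inord
    (nth 0 (nth [::] [:: [:: 0; 3; 4]; [:: 5; 1; 6]; [:: 7; 8; 2]] i) j)%N).

(** The substitution x_i |-> x_i + e m_i turns x_i^3 into x_i^3 + 3e x_i^2 m_i
    modulo e^2; hence the factor 1/3. *)
Definition tangent_mx (v : 'I_10 -> K) : 'M[K]_3 :=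
  \matrix_(i, j) (3%:R^-1 * tangent_coef v i j).

(** At the Fermat cubic, linear substitutions together with motion in the
    pencil reach every tangent direction [v] of the space of cubics: the
    substitutions produce the x_i^2 x_j and the pencil produces xyz. *)
Lemma hesse_pencil_curve (v : 'I_10 -> K) :
  exists B : {mpoly {poly K}[3]},
    subst_form (1%:M + 'X *: map_mx polyC (tangent_mx v))
               (hesse_form 1 ('X * (v (inord 9))%:P)) =
    hesse_form 1 0 + ('X)%:MP * (cubic_form (polyC \o v) + ('X)%:MP * B).
Proof.
pose A := tangent_mx v; pose e : {mpoly {poly K}[3]} := ('X)%:MP.
pose m i : {mpoly {poly K}[3]} := \sum_j (A i j)%:P *: 'X_j.
have lE i : subst_form (1%:M + 'X *: map_mx polyC A) 'X_i = 'X_i + e * m i.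
  rewrite subst_formX /m mulr_sumr (bigD1 i) //=.
  rewrite [in RHS](bigD1 i) //= addrA; congr (_ + _).
    by rewrite !mxE eqxx scalerDl scale1r mul_mpolyC scalerA.
  apply: eq_bigr => j /negPf ne_ji.
  by rewrite !mxE eq_sym ne_ji add0r mul_mpolyC scalerA.
have substE a b : subst_form (1%:M + 'X *: map_mx polyC A) (hesse_form a b) =
    a *: ((subst_form (1%:M + 'X *: map_mx polyC A) 'X_o0) ^+ 3
        + (subst_form (1%:M + 'X *: map_mx polyC A) 'X_o1) ^+ 3
        + (subst_form (1%:M + 'X *: map_mx polyC A) 'X_o2) ^+ 3)
    + b *: ((subst_form (1%:M + 'X *: map_mx polyC A) 'X_o0)
          * (subst_form (1%:M + 'X *: map_mx polyC A) 'X_o1)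
          * (subst_form (1%:M + 'X *: map_mx polyC A) 'X_o2)).
  rewrite hesse_formE /subst_form rmorphD /= !comp_mpolyZ !rmorphD !rmorphXn.
  by rewrite !rmorphM.
have m3 i : 3%:R * m i = \sum_j (tangent_coef v i j)%:P *: 'X_j.
  rewrite mulr_sumr; apply: eq_bigr => j _.
  have -> : tangent_coef v i j = 3%:R * A i j.
    by rewrite mxE mulrA divff ?mul1r ?pnatr_eq0.
  rewrite -!mul_mpolyC rmorphM rmorph_nat mpolyCM.
  by rewrite -[3%:R%:MP]/(mpolyC 3 3%:R) rmorph_nat mulrA.
have VE : 'X_o0 ^+ 2 * (3%:R * m o0) + 'X_o1 ^+ 2 * (3%:R * m o1)
    + 'X_o2 ^+ 2 * (3%:R * m o2)
    + (v (inord 9))%:P%:MP * ('X_o0 * 'X_o1 * 'X_o2) = cubic_form (polyC \o v).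
  by rewrite !m3 !sum3E cubic_formE /= -!mul_mpolyC; ring.
rewrite substE !lE scale1r -mul_mpolyC mpolyCM curve_expansion VE.
by rewrite hesse_formE scale1r scale0r addr0; eexists.
Qed.

(** The invariant vanishes on the curves of [hesse_pencil_curve], at first only
    at the parameters where the substitution is invertible; multiplying by its
    determinant removes that restriction. *)
Lemma invariant_eq0 (I : {mpoly K[10]}) d :
    I \is d.-homog -> SL3_invariant I ->
    (forall u, I.@[hesse_coefs 1 u] = 0) ->
  I = 0.
Proof.
move=> I_hom I_inv I_pencil.
apply: (mpoly_eq0_by_curves (p0 := hesse_coefs 1 0)) => v.
have [B BE] := hesse_pencil_curve v; exists (form_coefs B).
pose G := 1%:M + 'X *: map_mx polyC (tangent_mx v).
pose Phi := subst_form G (hesse_form 1 ('X * (v (inord 9))%:P)).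
have -> : mmap polyC (fun i => (hesse_coefs 1 0 i)%:P
      + 'X * ((v i)%:P + 'X * form_coefs B i)) I =
    mmap polyC (form_coefs Phi) I.
  apply: eq_mmap => i; rewrite /Phi BE /form_coefs !(mcoeffD, mcoeffCM).
  rewrite -!/(form_coefs _ _) !cubic_formK; congr (_ + _).
  by rewrite /hesse_coefs; case: ifP => // _; case: ifP.
set q := mmap _ _ _.
have GE x : map_mx (horner_eval x) G = 1%:M + x *: tangent_mx v.
  apply/matrixP => i j; rewrite !mxE /horner_eval.
  rewrite hornerD hornerM hornerX hornerC.
  by case: (i == j); rewrite ?hornerC.
have qE x : q.[x] = I.@[coefs (lin_subst (1%:M + x *: tangent_mx v)
                         (hesse_form 1 (x * v (inord 9))))].
  rewrite -GE; apply: (rmorph_mmap (psi := horner_eval x)) => [c|i].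
    exact: hornerC.
  rewrite (map_form_coefs (horner_eval x)) (map_subst_form (horner_eval x)).
  rewrite map_cubic_form.
  rewrite /coefs lin_substE /form_coefs /hesse_form.
  congr ((subst_form _ _)@__).
  apply: eq_cubic_form => j; rewrite /= (map_hesse_coefs (horner_eval x)).
  by rewrite rmorph1 /= /horner_eval hornerM hornerX hornerC.
have : \det G * q = 0.
  apply: poly_eq0_by_eval => x; rewrite hornerM qE.
  have -> : (\det G).[x] = \det (1%:M + x *: tangent_mx v).
    by rewrite -GE det_map_mx.
  have [->|g0] := eqVneq (\det (1%:M + x *: tangent_mx v)) 0.
    by rewrite mul0r.
  rewrite (invariant_lin_subst I_hom I_inv) ?cubic_form_homog //.
  rewrite (_ : I.@[_] = 0) ?mulr0 // -[RHS](I_pencil (x * v (inord 9))).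
  by apply: meval_eq => i; exact: cubic_formK.
move/eqP; rewrite mulf_eq0 => /orP[/eqP G0|/eqP //].
have := congr1 (horner_eval 0) G0.
rewrite -det_map_mx GE scale0r addr0 det1 /horner_eval horner0 => /eqP.
by rewrite oner_eq0.
Qed.

End Density.

(** * Pulling back invariants along the Hessian *)

Section Pullback.
Variable K : numFieldType.

Definition generic_cubic : {mpoly {mpoly K[10]}[3]} :=
  cubic_form (fun i => 'X_i).

(** The polynomial function F |-> I (He F): the coefficients of the Hessian of
    the generic cubic are substituted for the variables of [I]. *)
Definition hessian_pullback (I : {mpoly K[10]}) : {mpoly K[10]} :=
  I \mPo [tuple form_coefs (hessian_form generic_cubic) i | i < 10].

Definition aronhold_S : {mpoly K[10]} := aronhold generic_cubic.

Lemma map_generic_cubic (S : comNzRingType) (phi : {rmorphism K -> S}) v :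
  map_mpoly (mmap phi v) generic_cubic = cubic_form v.
Proof.
rewrite map_cubic_form; apply: eq_cubic_form => i.
by rewrite /= mmapX mmap1U.
Qed.

Lemma mmap_hessian_pullback (S : comNzRingType) (phi : {rmorphism K -> S}) v I :
  mmap phi v (hessian_pullback I) =
  mmap phi (form_coefs (hessian_form (cubic_form v))) I.
Proof.
apply: (rmorph_mmap (psi := mmap phi v)) => [c|i]; first by rewrite /= mmapC.
rewrite tnth_mktuple (map_form_coefs (mmap phi v)) map_hessian_form.
by rewrite map_generic_cubic.
Qed.

Lemma meval_hessian_pullback I (F : {mpoly K[3]}) : F \is 3.-homog ->
  (hessian_pullback I).@[coefs F] = I.@[coefs (hessian F)].
Proof.
by move=> F_hom; rewrite [LHS](mmap_hessian_pullback idfun) form_coefsK.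
Qed.

Lemma hessian_pullback_homog I d :
  I \is d.-homog -> hessian_pullback I \is (3 * d).-homog.
Proof.
move=> I_hom; apply: dhomog_by_scaling => c v.
rewrite [LHS](mmap_hessian_pullback idfun).
rewrite [X in _ * X](mmap_hessian_pullback idfun).
rewrite exprM -(dhomog_mmap _ _ _ I_hom); apply: eq_mmap => i.
by rewrite cubic_formZ hessian_formZ /form_coefs mcoeffZ.
Qed.

Lemma subst_form_homog g (F : {mpoly K[3]}) d :
  F \is d.-homog -> subst_form g F \is d.-homog.
Proof.
move=> F_hom; apply: dhomog_by_scaling => c v.
rewrite !comp_mpoly_meval -(dhomog_meval _ _ F_hom); apply: meval_eq => i.
rewrite tnth_mktuple !raddf_sum mulr_sumr; apply: eq_bigr => j _ /=.
by rewrite !mevalZ !mevalXU mulrCA.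
Qed.

Lemma hessian_pullback_invariant I :
  SL3_invariant I -> SL3_invariant (hessian_pullback I).
Proof.
move=> I_inv g F g1 F_hom.
have gF_hom := subst_form_homog g F_hom.
rewrite (meval_hessian_pullback _ gF_hom) (meval_hessian_pullback _ F_hom).
have -> : hessian (lin_subst g F) = lin_subst g (hessian F).
  by rewrite [LHS]hessian_form_subst g1 expr1n scale1r.
by apply: I_inv; last exact: hessian_homog.
Qed.

Lemma meval_aronhold_S v : aronhold_S.@[v] = aronhold (cubic_form v).
Proof. by rewrite (map_aronhold (meval v)) (map_generic_cubic idfun). Qed.

Lemma aronhold_S_homog : aronhold_S \is 4.-homog.
Proof.
apply: dhomog_by_scaling => c v; rewrite !meval_aronhold_S -aronholdZ.
by rewrite cubic_formZ.
Qed.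

Lemma aronhold_S_invariant : SL3_invariant aronhold_S.
Proof.
move=> g F g1 F_hom; rewrite !meval_aronhold_S !form_coefsK ?aronhold_subst //.
exact: subst_form_homog.
Qed.

End Pullback.

(** * The function field of El_3 inside K(t) *)

Section InvariantFractions.
Variable K : numClosedFieldType.

Definition El3_quotient (x : El3_field K) (f g : {mpoly K[10]}) : Prop :=
  exists d, invariant_fraction (El3_val x) d f g.

Lemma El3_val1 : El3_val (1 : El3_field K) = 1.
Proof. exact: (rmorph1 (val : El3_field K -> _)). Qed.

Lemma El3_valB (x y : El3_field K) : El3_val (x - y) = El3_val x - El3_val y.
Proof. exact: (rmorphB (val : El3_field K -> _)). Qed.

Lemma El3_valM (x y : El3_field K) : El3_val (x * y) = El3_val x * El3_val y.
Proof. by rewrite -[LHS]/(val (x * y)) rmorphM. Qed.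

Lemma SL3_invariantC a : SL3_invariant (a%:MP : {mpoly K[10]}).
Proof. by move=> s F _ _; rewrite !mevalC. Qed.

Lemma SL3_invariantM (f g : {mpoly K[10]}) :
  SL3_invariant f -> SL3_invariant g -> SL3_invariant (f * g).
Proof. by move=> hf hg s F ds hF; rewrite !mevalM hf // hg. Qed.

Lemma SL3_invariantB (f g : {mpoly K[10]}) :
  SL3_invariant f -> SL3_invariant g -> SL3_invariant (f - g).
Proof. by move=> hf hg s F ds hF; rewrite !mevalB hf // hg. Qed.

Lemma El3_quotient_morphism (M : fieldType)
    (sigma : {rmorphism {mpoly K[10]} -> M}) :
    (forall g d, g \is d.-homog -> SL3_invariant g -> g != 0 -> sigma g != 0) ->
  exists h : {rmorphism El3_field K -> M},
    forall x f g, El3_quotient x f g -> h x = sigma f / sigma g.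
Proof.
move=> sigma_neq0; apply: extend_to_fractions.
- by move=> x; have /asboolP[d [f [g xE]]] := El3_valP x; exists f, g, d.
- by move=> x f g [d [_ [g_hom g_inv] g0 _]]; exact: sigma_neq0 g_hom g_inv g0.
- move=> x f g f' g' [d [_ _ g0 xE]] [d' [_ _ g'0]]; rewrite xE => /eqP.
  by rewrite eqr_div ?tofrac_eq0 // -!rmorphM /= tofrac_eq => /eqP.
- exists 0%N; split; last by rewrite El3_val1 rmorph1 divr1.
  + by split; [exact: dhomog1 | exact: SL3_invariantC].
  + by split; [exact: dhomog1 | exact: SL3_invariantC].
  + exact: oner_neq0.
- move=> x f g y f' g' [d [[hf If] [hg Ig] g0 xE]].
  move=> [d' [[hf' If'] [hg' Ig'] g'0 yE]]; exists (d + d')%N; split.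
  + split; last by apply: SL3_invariantB; apply: SL3_invariantM.
    by rewrite rpredB //; [|rewrite addnC]; apply: dhomogM.
  + by split; [apply: dhomogM | apply: SL3_invariantM].
  + by rewrite mulf_neq0.
  + rewrite El3_valB xE yE rmorphB !rmorphM -[- (tofrac f' / _)]mulNr.
    by rewrite addf_div ?tofrac_eq0 // mulNr.
- move=> x f g y f' g' [d [[hf If] [hg Ig] g0 xE]].
  move=> [d' [[hf' If'] [hg' Ig'] g'0 yE]]; exists (d + d')%N; split.
  + by split; [apply: dhomogM | apply: SL3_invariantM].
  + by split; [apply: dhomogM | apply: SL3_invariantM].
  + by rewrite mulf_neq0.
  + by rewrite El3_valM xE yE mulf_div !rmorphM.
Qed.

Lemma El3_quotient_ex d (f g : {mpoly K[10]}) :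
    f \is d.-homog -> SL3_invariant f -> g \is d.-homog -> SL3_invariant g ->
    g != 0 ->
  exists x, El3_quotient x f g.
Proof.
move=> hf If hg Ig g0.
have xP : El3_pred (tofrac f / tofrac g : {fraction {mpoly K[10]}}).
  by apply/asboolP; exists d, f, g.
by exists (El3_fun xP), d.
Qed.

End InvariantFractions.

Lemma hessian_parameter_scaled (F : fieldType) (t x : F) :
  3%:R * x * t ^+ 2 = - (t ^+ 3 + 108%:R) ->
  - 6%:R * t ^+ 2 * x = 216%:R + 2%:R * t ^+ 3.
Proof.
move=> tx; have -> : - 6%:R * t ^+ 2 * x = - 2%:R * (3%:R * x * t ^+ 2) by ring.
by rewrite tx; ring.
Qed.

Section HesseRestriction.
Variable K : numClosedFieldType.
Local Notation M := {fraction {poly K}}.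
Local Notation t := (fraction_var K).
Local Notation cst := (fraction_const K).
Local Notation s := (hessian_parameter K).

Definition pencil_eval : {rmorphism {mpoly K[10]} -> M} :=
  mmap cst (hesse_coefs 1 t).

Definition pencil_poly : {rmorphism {mpoly K[10]} -> {poly K}} :=
  mmap polyC (hesse_coefs 1 'X).

Lemma tofrac_pencil_poly I : tofrac (pencil_poly I) = pencil_eval I.
Proof.
apply: (rmorph_mmap (psi := @tofrac {poly K})) => [//|i].
by rewrite (map_hesse_coefs (@tofrac {poly K})) rmorph1.
Qed.

Lemma horner_pencil_poly I u : (pencil_poly I).[u] = I.@[hesse_coefs 1 u].
Proof.
apply: (rmorph_mmap (psi := horner_eval u)) => [c|i]; first exact: hornerC.
by rewrite (map_hesse_coefs (horner_eval u)) rmorph1 /= /horner_eval hornerX.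
Qed.

(** Restriction to the pencil is thus defined on all quotients of invariants. *)
Lemma pencil_eval_neq0 (g : {mpoly K[10]}) d :
  g \is d.-homog -> SL3_invariant g -> g != 0 -> pencil_eval g != 0.
Proof.
move=> g_hom g_inv; apply: contra_neq => g0.
apply: (invariant_eq0 g_hom g_inv) => u; rewrite -horner_pencil_poly.
suff -> : pencil_poly g = 0 by rewrite horner0.
by apply/eqP; rewrite -tofrac_eq0 tofrac_pencil_poly g0.
Qed.

Variable theta : {rmorphism M -> M}.
Hypothesis theta_t : theta t = s.
Hypothesis theta_cst : forall a, theta (cst a) = cst a.

(** On quotients of invariants of the same degree d the factor (-6t^2)^d
    cancels, so that pulling back along the Hessian becomes [theta]. *)
Lemma pencil_eval_pullback (f : {mpoly K[10]}) d : f \is d.-homog ->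
  pencil_eval (hessian_pullback f) =
  (- 6%:R * t ^+ 2) ^+ d * theta (pencil_eval f).
Proof.
move=> f_hom; rewrite [LHS]mmap_hessian_pullback.
rewrite [theta _](rmorph_mmap (psi := theta) (g := cst)
  (w := hesse_coefs 1 s)) //; last first.
  by move=> i; rewrite map_hesse_coefs rmorph1 theta_t.
rewrite -(dhomog_mmap _ _ _ f_hom); apply: eq_mmap => i.
rewrite -/(hesse_form 1 t) hessian_hesse_form cubic_formK hesse_coefsZ.
have ls : - 6%:R * t ^+ 2 * s = 216%:R + 2%:R * t ^+ 3.
  apply: hessian_parameter_scaled; apply: hessian_parameter_eq.
  exact: hessian_parameter_den_neq0.
by rewrite !mulr1 expr1n mulr1 ls.
Qed.

Lemma pencil_factor_neq0 : - 6%:R * t ^+ 2 != 0.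
Proof.
apply: mulf_neq0; first by rewrite oppr_eq0; exact: fraction_natr_neq0.
by apply: expf_neq0; exact: fraction_var_neq0.
Qed.

(** The Hessian map is dominant on El_3: by [pencil_eval_pullback] its effect on
    the pencil is the injective [theta]. *)
Lemma hessian_pullback_neq0 (g : {mpoly K[10]}) d :
  g \is d.-homog -> SL3_invariant g -> g != 0 -> hessian_pullback g != 0.
Proof.
move=> g_hom g_inv g0.
apply: contra_neq (pencil_eval_neq0 g_hom g_inv g0) => h0.
have := pencil_eval_pullback g_hom; rewrite h0 rmorph0 => /esym/eqP.
rewrite mulf_eq0 expf_eq0 (negPf pencil_factor_neq0) andbF /= fmorph_eq0.
by move/eqP.
Qed.

Lemma hessian_pullback_morphism :
  exists H : {rmorphism El3_field K -> El3_field K},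
  forall x d f g, invariant_fraction (El3_val x) d f g ->
    invariant_fraction (El3_val (H x)) (3 * d)
      (hessian_pullback f) (hessian_pullback g).
Proof.
pose sigma : {rmorphism {mpoly K[10]} -> {fraction {mpoly K[10]}}} :=
  @tofrac {mpoly K[10]} \o
  comp_mpoly [tuple form_coefs (hessian_form (generic_cubic K)) i | i < 10].
have [|h hE] := @El3_quotient_morphism K _ sigma.
  move=> g d g_hom g_inv g0; rewrite tofrac_eq0.
  exact: hessian_pullback_neq0 g_hom g_inv g0.
have hP x d f g : invariant_fraction (El3_val x) d f g ->
    invariant_fraction (h x) (3 * d) (hessian_pullback f) (hessian_pullback g).
  move=> xE; have [[hf If] [hg Ig] g0 _] := xE; split.
  - split; first exact: hessian_pullback_homog.
    exact: hessian_pullback_invariant.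
  - split; first exact: hessian_pullback_homog.
    exact: hessian_pullback_invariant.
  - exact: hessian_pullback_neq0 hg Ig g0.
  - by rewrite (hE x f g) //; exists d.
have h_El3 x : El3_pred (h x).
  have /asboolP[d [f [g xE]]] := El3_valP x.
  apply/asboolP.
  by exists (3 * d)%N, (hessian_pullback f), (hessian_pullback g); exact: hP.
pose H x := El3_fun (h_El3 x).
have H_zmod : zmod_morphism H.
  move=> x y; apply: val_inj.
  exact: etrans (rmorphB h x y) (esym (El3_valB (H x) (H y))).
have H_monoid : monoid_morphism H.
  split=> [|x y]; apply: val_inj.
    exact: etrans (rmorph1 h) (esym (El3_val1 K)).
  exact: etrans (rmorphM h x y) (esym (El3_valM (H x) (H y))).
pose hz := GRing.isZmodMorphism.Build _ _ H H_zmod.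
pose hm := GRing.isMonoidMorphism.Build _ _ H H_monoid.
pose Hr : {rmorphism El3_field K -> El3_field K} := HB.pack H hz hm.
by exists Hr => x d f g; exact: hP.
Qed.

End HesseRestriction.

(** * The degree *)

Section Degree.
Variable K : numClosedFieldType.
Local Notation M := {fraction {poly K}}.
Local Notation t := (fraction_var K).
Local Notation cst := (fraction_const K).
Local Notation s := (hessian_parameter K).

Lemma semistable_aronhold (F : {mpoly K[3]}) :
  F \is 3.-homog -> aronhold F != 0 -> semistable F.
Proof.
move=> F_hom F0; exists 4, (aronhold_S K); split=> //.
- exact: aronhold_S_homog.
- exact: aronhold_S_invariant.
- by rewrite meval_aronhold_S form_coefsK.
Qed.

(** The triangle xyz is semistable, and its Hessian is 2xyz. *)
Lemma hessian_semistable : exists F : {mpoly K[3]},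
  [/\ F \is 3.-homog, semistable F & semistable (hessian F)].
Proof.
have nz (n : nat) : (n.+1%:R : K) != 0 by rewrite pnatr_eq0.
have hesse01 : hessian (hesse_form (0 : K) 1) = hesse_form 0 2%:R.
  rewrite hessianE hessian_hesse_form mulr0 mul0r expr0n /= mulr0 add0r.
  by rewrite expr1n mulr1.
exists (hesse_form 0 1); split; first exact: cubic_form_homog.
  apply: semistable_aronhold; first exact: cubic_form_homog.
  by rewrite aronhold_hesse_form expr0n mulr0 subr0 expr1n !mulr1 nz.
rewrite hesse01; apply: semistable_aronhold; first exact: cubic_form_homog.
by rewrite aronhold_hesse_form expr0n mulr0 subr0 !mulf_neq0 ?expf_neq0 ?nz.
Qed.

(** The restrictions p and q to the pencil of S (He F) and of S(F)^3, two
    invariants of degree 12, satisfy q(0) = 0 and p(0) <> 0.  With J in E their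
    quotient, t is a root of the polynomial p(X) - J q(X) over E, whose constant
    coefficient is p(0). *)
Lemma pencil_restriction_algebraic (rho : {rmorphism El3_field K -> M}) :
    (forall x f g, El3_quotient x f g ->
       rho x = pencil_eval K f / pencil_eval K g) ->
  (forall a, exists l, rho l = cst a) /\
  exists2 P : {poly El3_field K}, P != 0 & root (map_poly rho P) t.
Proof.
move=> rhoE.
have rho_cst a : exists l, rho l = cst a.
  have a_hom : (a%:MP_[10] : {mpoly K[10]}) \is 0.-homog.
    by rewrite -[a%:MP_[10]]mulr1 mul_mpolyC rpredZ // dhomog1.
  have [x xE] := El3_quotient_ex a_hom (SL3_invariantC a)
    (dhomog1 _ _) (SL3_invariantC 1) (oner_neq0 _).
  exists x; rewrite (rhoE _ _ _ xE) rmorph1 divr1.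
  exact: mmapC.
split=> //; have /choice[kappa kappaE] := rho_cst.
pose f := hessian_pullback (aronhold_S K); pose g := aronhold_S K ^+ 3.
pose p := pencil_poly K f; pose q := pencil_poly K g.
have p0 : p`_0 = 24%:R * 216%:R ^+ 4.
  rewrite -horner_coef0 horner_pencil_poly [LHS](mmap_hessian_pullback idfun).
  rewrite [LHS]meval_aronhold_S form_coefsK; last first.
    by rewrite -hessianE hessian_homog // cubic_form_homog.
  rewrite -/(hesse_form 1 0) hessian_hesse_form aronhold_hesse_form; ring.
have q0 : q`_0 = 0.
  rewrite -horner_coef0 horner_pencil_poly rmorphXn /= meval_aronhold_S.
  by rewrite -/(hesse_form 1 0) aronhold_hesse_form mulr0 mul0r expr0n.
have S0 : aronhold_S K != 0.
  have nz : 24%:R != 0 :> K by rewrite pnatr_eq0.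
  apply: contra_neq nz => S0; have := meval_aronhold_S (hesse_coefs (0 : K) 1).
  rewrite S0 meval0 -/(hesse_form 0 1) aronhold_hesse_form => ->; ring.
have [J JE] : exists J, El3_quotient J f g.
  apply: (@El3_quotient_ex _ 12).
  - exact: (hessian_pullback_homog (aronhold_S_homog K)).
  - exact: hessian_pullback_invariant (@aronhold_S_invariant K).
  - exact: (dhomogMn 3 (aronhold_S_homog K)).
  - have S_inv := @aronhold_S_invariant K.
    exact: SL3_invariantM S_inv (SL3_invariantM S_inv S_inv).
  - by rewrite expf_neq0.
pose N := maxn (size p) (size q).
pose P := \poly_(i < N) (kappa p`_i - J * kappa q`_i).
have cst_coef (r : {poly K}) i : (map_poly cst r)`_i = cst r`_i.
  exact: coef_map.
have rho_coef (r : {poly El3_field K}) i : (map_poly rho r)`_i = rho r`_i.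
  exact: coef_map.
have PE : map_poly rho P = map_poly cst p - rho J *: map_poly cst q.
  apply/polyP => i; rewrite coefB coefZ rho_coef !cst_coef coef_poly.
  case: ltnP => [_|]; first by rewrite rmorphB rmorphM !kappaE.
  rewrite geq_max => /andP[szp szq]; rewrite !nth_default // !rmorph0.
  by rewrite mulr0 subr0.
exists P.
  apply/eqP => P0; have := congr1 (fun r : {poly M} => r`_0) PE.
  rewrite P0 rmorph0 coef0 coefB coefZ !cst_coef p0 q0 rmorph0 mulr0 subr0.
  by move/esym/eqP; rewrite fmorph_eq0 mulf_eq0 expf_eq0 !pnatr_eq0.
rewrite /root PE hornerD hornerN hornerZ -!tofrac_horner !tofrac_pencil_poly.
rewrite (rhoE _ _ _ JE) divfK ?subrr //.
have [d [_ [g_hom g_inv] g0 _]] := JE.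
exact: pencil_eval_neq0 g_hom g_inv g0.
Qed.

Theorem hessian_degree : exists H : {rmorphism El3_field K -> El3_field K},
  is_comorphism (@hessian K) H /\ extension_degree H 3.
Proof.
have [theta [theta_t theta_cst]] := hessian_parameter_lift K.
have [H HE] := hessian_pullback_morphism theta_t theta_cst.
exists H; split.
  split; first exact: hessian_semistable.
  move=> F phi v F_hom _ _ [d [f [g [phiE gF ->]]]].
  exists (3 * d)%N, (hessian_pullback f), (hessian_pullback g).
  by split; rewrite ?meval_hessian_pullback //; exact: HE.
have [rho rhoE] := El3_quotient_morphism (@pencil_eval_neq0 K).
have comm x : theta (rho x) = rho (H x).
  have /asboolP[d [f [g xE]]] := El3_valP x.
  have [[f_hom _] [g_hom _] _ _] := xE.
  rewrite (rhoE x f g); last by exists d.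
  rewrite (rhoE (H x) (hessian_pullback f) (hessian_pullback g)); last first.
    by exists (3 * d)%N; exact: HE.
  rewrite !(pencil_eval_pullback theta_t theta_cst (d := d)) // fmorph_div.
  rewrite -mulf_div divff ?mul1r // expf_neq0 //.
  exact: pencil_factor_neq0.
have [rho_cst [P P0 P_root]] := pencil_restriction_algebraic rhoE.
have [n [u [fu su]]] :=
  bounded_free_basis
    (fun k b => free_over_bound (k := k) (b := b) rho_cst P0 P_root).
have [w [fw sw]] := hessian_parameter_basis theta_t theta_cst.
have [e [fe se]] := conjugate_basis comm fu su fw sw.
exists e => y; have [c yE] := se y.
exists [ffun i => c i]; split=> [|c' yE'].
  by rewrite yE; apply: eq_bigr => i _; rewrite ffunE.
apply/ffunP => i; rewrite ffunE; apply/eqP; rewrite -subr_eq0; apply/eqP.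
apply: (fe (fun i => c i - c' i)).
under eq_bigr do rewrite rmorphB mulrBl.
by rewrite sumrB -yE -yE' subrr.
Qed.

End Degree.

Theorem theorem1 (R : realType) :
  exists H : {rmorphism El3_field R[i] -> El3_field R[i]},
    is_comorphism (@hessian R[i]) H /\ extension_degree H 3.
Proof. exact: hessian_degree. Qed.
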